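(* The map $\mathcal{C}(x,\xi) \equiv \pi_{\mathcal{M}} \circ \pi_M^{-1}(x,\xi)$ is a local diffeomorphism from $T^*M\setminus 0$ to $T^*\mathcal{M}\setminus 0$. Moreover, we have $\mathcal{C}(p_1,\xi^1)=\mathcal{C}(p_2,\xi^2)$ if and only if there is a curve $t\mapsto\gamma(y,\eta,t)$ of the family joining $p_1$ at $t_1$ and $p_2$ at $t_2$, with $t_2>t_1$, such that (a) $p_2$ is conjugate to $p_1$; (b) $\xi^1=\mu\, a_1(t_2)\,\dot\gamma^\perp(t_1)$ and $\xi^2=\mu\, a_1(t_1)\,\dot\gamma^\perp(t_2)$ for some nonzero $\mu$, where $a_1(t)=\left(\dot\gamma^\perp(y,\eta,t),\frac{\partial\gamma}{\partial y}(y,\eta,t)\right)_g$. In particular, if there are no conjugate points, then the Bolker condition is satisfied and $\mathcal{C}$ is a diffeomorphism.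
   Context: $M\subset\mathbb{R}^2$ is a bounded domain with a Riemannian metric $g$, and $SM$ is its unit circle bundle. $\Gamma$ is a family of smooth curves such that for each $(x,v)\in TM\setminus 0$ there is exactly one curve of $\Gamma$ passing through $x$ in the direction of $v$ (with $\gamma(0)=x$ and $\dot\gamma(0)=m(x,v)v$ for a smooth function $m>0$), depending smoothly on $(x,v)$ and solving a second order ODE $D_t\dot\gamma=G(\gamma,\dot\gamma)$ with $G$ smooth and invariantly defined on $TM$ ($D_t$ is the covariant derivative along $\gamma$; under a change of coordinates $x\mapsto\tilde x$ of $M$, $G$ transforms as $\widetilde G^i=\frac{\partial\tilde x^i}{\partial x^j}G^j$). The curves are reparameterized by $g$-arc length: for $(x,v)\in SM$, $\gamma_{x,v}(t)$ is the unit speed curve of $\Gamma$ with $\gamma_{x,v}(0)=x$, $\dot\gamma_{x,v}(0)=v$, and it solves $D_t\dot\gamma=\lambda(\gamma,\dot\gamma)\dot\gamma^\perp$ for some $\lambda\in C^\infty(SM)$, where $u^\perp$ denotes the rotation of the vector $u$ by $\pi/2$ (same length). The flow on $SM$ is $\phi_t(x,v)=(\gamma_{x,v}(t),\dot\gamma_{x,v}(t))$, and $\mathcal{M}=SM/\phi_t$ is the two-dimensional smooth manifold of curves. Conjugate points: put $\exp_p(t,v)=\gamma_{p,v}(t)$ for $(p,v)\in SM$. The point $q=\gamma_{p,v}(t_0)$ is conjugate to $p=\gamma_{p,v}(0)$ if the differential of $(t,v)\mapsto\exp_p(t,v)$, $t\in\mathbb{R}$, $v\in S_pM$, has rank less than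 the maximal one at $(t_0,v)$. For two points at times $t_1$ and $t_2$ of a curve $\gamma$, this is applied with $p=\gamma(t_1)$, $v=\dot\gamma(t_1)$, $t_0=t_2-t_1$. Local parameterization of $\mathcal{M}$: fix a curve $\gamma\in\Gamma$ and a hypersurface $H$ that $\gamma$ hits transversally at $p_0=\gamma(0)$ with $v_0=\dot\gamma(0)$. In local coordinates $(x^1,y)$, $H=\{x^1=0\}$. Curves near $\gamma$ are parameterized by $(y,\eta)$, where $\eta$ is a parameterization of the unit direction $v\in S_{(0,y)}M$ (transversal to $H$, with $((0,y),v)$ near $(p_0,v_0)$), and $\gamma(y,\eta,t)$ denotes the unit speed curve of $\Gamma$ starting at $t=0$ from $(0,y)$ in the direction $v$; the variables $y,\eta$ are omitted when no confusion arises. Thus $(y,\eta)$ are local coordinates on $\mathcal{M}$, with dual variables $(\hat y,\hat\eta)$. All statements are understood in this local setting: $\mathcal{M}$ stands for the curves near the fixed $\gamma$, and the covectors in $T^*M\setminus0$ considered are those conormal to these curves. Canonical relation: using $g$ to identify vectors with covectors, let $$C=\{(y,\eta,\hat y,\hat\eta,x,\xi):\ \hat y=\mu a_1,\ \hat\eta=\mu b_1,\ x=\gamma(y,\eta,t),\ \xi=\mu\dot\gamma^\perp(y,\eta,t),\ \mu\ne0\},$$ where $a_1=(\dot\gamma^\perp,\partial\gamma/\partial y)_g$ and $b_1=(\dot\gamma^\perp,\partial\gamma/\partial\eta)_g$, evaluated at $(y,\eta,t)$. This is the canonical relation of the integral transform $I_wf(\gamma)=\int w(\gamma(t),\dot\gamma(t))f(\gamma(t))\,dt$,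 $\gamma\in\Gamma$, with weight $w$, acting on distributions $f$ compactly supported in $M$. The maps $\pi_M:C\to T^*M\setminus0$, $(y,\eta,\hat y,\hat\eta,x,\xi)\mapsto(x,\xi)$, and $\pi_{\mathcal{M}}:C\to T^*\mathcal{M}\setminus0$, $(y,\eta,\hat y,\hat\eta,x,\xi)\mapsto(y,\eta,\hat y,\hat\eta)$, are the natural projections; $\pi_M$ is a diffeomorphism in this setting, so $\pi_M^{-1}$ makes sense. The Bolker condition is said to be satisfied if $\pi_{\mathcal{M}}$ is an injective immersion.
   Formalization: The equivalence is for distinct covectors, up to the order of the two points; if a_1 vanishes at both times, where (b) would force zero covectors, (b) is stated with b_1 instead; ''diffeomorphism'' means onto its open image, as C need not be onto. *)

(* Defs.v *)
From HB Require Import structures.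
From mathcomp Require Import all_boot all_order all_algebra.
From mathcomp Require Import all_classical all_reals all_analysis.

Set Implicit Arguments.
Unset Strict Implicit.
Unset Printing Implicit Defensive.

Import Order.TTheory GRing.Theory Num.Theory.
Import numFieldNormedType.Exports.

Local Open Scope classical_set_scope.
Local Open Scope ring_scope.

Section Smoothness.
Context {R : realType}.
Implicit Types V W : normedModType R.

Fixpoint iter_derive V W (vs : seq V) (f : V -> W) : V -> W :=
  if vs is v :: vs' then (fun x => 'D_v (iter_derive vs' f) x) else f.

(* C^oo on an open set: all iterated directional derivatives exist and are
   differentiable (hence continuous) there. *)
Definition smooth_on V W (U : set V) (f : V -> W) : Prop :=
  forall vs x, U x -> differentiable (iter_derive vs f) x.

(* C^oo on a subset that need not be open, such as SM inside TM: local
   extensibility to a smooth function of the ambient space. *)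
Definition smooth_within V W (A : set V) (f : V -> W) : Prop :=
  forall p, A p -> exists (U : set V) (h : V -> W),
    [/\ open U, U p, smooth_on U h & forall q, U q -> A q -> h q = f q].

Definition relatively_open V (A D : set V) : Prop :=
  D `<=` A /\
  forall p, D p -> exists U : set V, [/\ open U, U p & U `&` A `<=` D].

Definition diffeo_onto_image V W (U : set V) (f : V -> W) : Prop :=
  [/\ open U, open (f @` U), smooth_on U f &
      exists h : W -> V, smooth_on (f @` U) h /\ forall x, U x -> h (f x) = x].

Definition local_diffeo V W (A : set V) (B : set W) (f : V -> W) : Prop :=
  (forall x, A x -> B (f x)) /\
  forall x, A x -> exists U : set V,
    [/\ U x, U `<=` A & diffeo_onto_image U f].

Definition immersion_on V W (U : set V) (f : V -> W) : Prop :=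
  smooth_on U f /\ forall x, U x -> injective ('d f x : V -> W).

End Smoothness.

Definition open_interval {R : realType} (I : set R) : Prop :=
  open I /\ is_interval I.

Section Geometry.
Context {R : realType}.
Local Notation E := 'rV[R]_2.
Implicit Types (M : set E) (g : E -> 'M[R]_2) (p q x u v w : E).

Definition bounded_domain M : Prop :=
  [/\ open M, connected M, M !=set0 & bounded_set M].

Definition inner g x u w : R := (u *m g x *m w^T) 0 0.

Definition gnorm g x u : R := Num.sqrt (inner g x u u).

Definition riemannian_metric M g : Prop :=
  smooth_on M g /\
  forall x, M x -> (g x)^T = g x /\ forall u, u != 0 -> 0 < inner g x u u.

Definition flat g x u : E := u *m g x.

(* Rotation by pi/2 for g, positively oriented for the coordinates of R^2: if
   (a, b) are the components of flat g x u, this is (-b, a) / sqrt (det g). *)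
Definition rot90 g x u : E :=
  (Num.sqrt (\det (g x)))^-1 *:
  \row_(k < 2) (if k == 0 then - flat g x u 0 1 else flat g x u 0 0).

Definition unit_bundle M g : set (E * E) :=
  [set z | M z.1 /\ inner g z.1 z.2 z.2 = 1].

Definition partial_metric g (i j k : 'I_2) x : R :=
  'D_(delta_mx 0 i : E) (fun z => g z j k) x.

Definition christoffel g (k i j : 'I_2) x : R :=
  2^-1 * \sum_(l < 2) invmx (g x) k l *
    (partial_metric g i j l x + partial_metric g j i l x
     - partial_metric g l i j x).

Definition velocity (c : R -> E) (t : R) : E := derive1 c t.

Definition cov_accel g (c : R -> E) (t : R) : E :=
  derive1 (velocity c) t +
  \row_(k < 2) \sum_(i < 2) \sum_(j < 2)
     christoffel g k i j (c t) * velocity c t 0 i * velocity c t 0 j.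

(* The family Gamma: [c x v], with parameter interval [J x v], is the curve
   through [x] in the direction of [v].  [cf_unique] says that it is the only
   one: it is also, up to a shift of the parameter, the curve selected by each
   of its points and directions there.  [G] is a vector-valued function in the
   coordinates of R^2; its components in other coordinates are those given by
   the transformation law of vectors. *)
Record curve_family M g (G : E -> E -> E) (m : E -> E -> R)
    (J : E -> E -> set R) (c : E -> E -> R -> E) : Prop := CurveFamily {
  cf_G_smooth : smooth_on [set z : E * E | M z.1] (fun z => G z.1 z.2);
  cf_m_smooth :
    smooth_on [set z : E * E | M z.1 /\ z.2 != 0] (fun z => m z.1 z.2 : R);
  cf_m_gt0 : forall x v, M x -> v != 0 -> 0 < m x v;
  cf_interval : forall x v, M x -> v != 0 -> open_interval (J x v) /\ J x v 0;
  cf_open :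
    open [set z : E * E * R | [/\ M z.1.1, z.1.2 != 0 & J z.1.1 z.1.2 z.2]];
  cf_smooth :
    smooth_on [set z : E * E * R | [/\ M z.1.1, z.1.2 != 0 & J z.1.1 z.1.2 z.2]]
      (fun z => c z.1.1 z.1.2 z.2);
  cf_init : forall x v, M x -> v != 0 ->
    c x v 0 = x /\ velocity (c x v) 0 = m x v *: v;
  cf_regular : forall x v t, M x -> v != 0 -> J x v t ->
    M (c x v t) /\ velocity (c x v) t != 0;
  cf_ode : forall x v t, M x -> v != 0 -> J x v t ->
    cov_accel g (c x v) t = G (c x v t) (velocity (c x v) t);
  cf_unique : forall x v s w k, M x -> v != 0 -> J x v s ->
    0 < k -> velocity (c x v) s = k *: w ->
    J (c x v s) w = [set t | J x v (s + t)] /\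
    forall t, J x v (s + t) -> c (c x v s) w t = c x v (s + t)
}.

(* [gam x v], on the interval [I x v], is the reparameterization of [c x v] by
   g-arc length.  [us_flow] is the flow property of
   phi_t(x,v) = (gam x v t, velocity (gam x v) t). *)
Record unit_speed_curves M g (J : E -> E -> set R) (c : E -> E -> R -> E)
    (I : E -> E -> set R) (gam : E -> E -> R -> E) : Prop := UnitSpeedCurves {
  us_arclength : forall x v, unit_bundle M g (x, v) ->
    exists s : R -> R,
      [/\ s 0 = 0,
          forall t, J x v t ->
            is_derive t (1 : R) s (gnorm g (c x v t) (velocity (c x v) t)),
          I x v = s @` J x v &
          forall t, J x v t -> gam x v (s t) = c x v t];
  us_interval : forall x v, unit_bundle M g (x, v) ->
    open_interval (I x v) /\ I x v 0;
  us_open : relatively_open [set z : E * E * R | unit_bundle M g z.1]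
    [set z : E * E * R | unit_bundle M g z.1 /\ I z.1.1 z.1.2 z.2];
  us_smooth : smooth_within
    [set z : E * E * R | unit_bundle M g z.1 /\ I z.1.1 z.1.2 z.2]
    (fun z => gam z.1.1 z.1.2 z.2);
  us_init : forall x v, unit_bundle M g (x, v) ->
    gam x v 0 = x /\ velocity (gam x v) 0 = v;
  us_unit : forall x v t, unit_bundle M g (x, v) -> I x v t ->
    unit_bundle M g (gam x v t, velocity (gam x v) t);
  us_flow : forall x v s, unit_bundle M g (x, v) -> I x v s ->
    I (gam x v s) (velocity (gam x v) s) = [set t | I x v (s + t)] /\
    forall t, I x v (s + t) ->
      gam (gam x v s) (velocity (gam x v) s) t = gam x v (s + t);
  us_ode : exists lam : E * E -> R,
    smooth_within (unit_bundle M g) lam /\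
    forall x v t, unit_bundle M g (x, v) -> I x v t ->
      cov_accel g (gam x v) t =
      lam (gam x v t, velocity (gam x v) t) *:
        rot90 g (gam x v t) (velocity (gam x v) t)
}.

(* (t, v') |-> exp_p(t, v') = gam p v' t near v' = v, with the unit circle S_pM
   parameterized by its angle from v; the row vector is (t, angle). *)
Definition exp_polar g (gam : E -> E -> R -> E) p v (z : 'rV[R]_2) : E :=
  gam p (cos (z 0 1) *: v + sin (z 0 1) *: rot90 g p v) (z 0 0).

Definition conjugate_along g (gam : E -> E -> R -> E) p v (t0 : R) : Prop :=
  let z0 : 'rV[R]_2 := \row_(k < 2) (if k == 0 then t0 else 0) in
  (\rank (jacobian (exp_polar g gam p v) z0) < 2)%N.

(* Local parameterization of the curves near the one issued from (p0, v0).
   [chart] is the inverse (x^1, y) |-> point of the local coordinates, defined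
   on [O], so that H is the image of {x^1 = 0}; [dir y eta] is the unit vector
   at (0, y) with parameter [eta]; [D] is the range of (y, eta). *)
Record local_parameterization M g (O : set (R * R)) (chart : R * R -> E)
    (D : set (R * R)) (dir : R -> R -> E) (y0 eta0 : R) p0 v0
    : Prop := LocalParameterization {
  lp_chart : diffeo_onto_image O chart;
  lp_chart_dom : forall z, O z -> M (chart z);
  lp_open : open D;
  lp_base : D (y0, eta0);
  lp_point : chart (0, y0) = p0;
  lp_direction : dir y0 eta0 = v0;
  lp_dom : forall y eta, D (y, eta) -> O (0, y);
  lp_smooth : smooth_on D (fun z => dir z.1 z.2);
  lp_unit : forall y eta, D (y, eta) -> unit_bundle M g (chart (0, y), dir y eta);
  lp_transversal : forall y eta, D (y, eta) ->
    forall k : R, dir y eta != k *: derive1 (fun y' => chart (0, y')) y;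
  lp_inj : forall y eta eta', D (y, eta) -> D (y, eta') ->
    dir y eta = dir y eta' -> eta = eta';
  lp_regular : forall y eta, D (y, eta) -> derive1 (dir y) eta != 0
}.

End Geometry.

Section CanonicalRelation.
Context {R : realType}.
Local Notation E := 'rV[R]_2.

(* T*M is described by pairs (x, xi), with xi the row vector of the components
   of a covector, and T*(manifold of curves) by ((y, eta), (yhat, etahat)). *)
Local Notation TsM := (E * E)%type.
Local Notation TsMM := ((R * R) * (R * R))%type.

Variables (g : E -> 'M[R]_2) (I : E -> E -> set R) (gam : E -> E -> R -> E).
Variables (chart : R * R -> E) (D : set (R * R)) (dir : R -> R -> E).

Definition curve (y eta t : R) : E := gam (chart (0, y)) (dir y eta) t.

Definition times (y eta : R) : set R := I (chart (0, y)) (dir y eta).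

Definition normal (y eta t : R) : E :=
  rot90 g (curve y eta t) (velocity (curve y eta) t).

Definition conormal (y eta t : R) : E :=
  flat g (curve y eta t) (normal y eta t).

Definition coef_a (y eta t : R) : R :=
  inner g (curve y eta t) (normal y eta t)
    (derive1 (fun y' => curve y' eta t) y).

Definition coef_b (y eta t : R) : R :=
  inner g (curve y eta t) (normal y eta t)
    (derive1 (fun eta' => curve y eta' t) eta).

(* C is the image of [param_dom] under [param]; the coordinates (y, eta, t, mu)
   give its manifold structure. *)
Definition param_dom : set (R * R * R * R) :=
  [set z | [/\ D z.1.1, times z.1.1.1 z.1.1.2 z.1.2 & z.2 != 0]].

Definition param (z : R * R * R * R) : TsMM * TsM :=
  let: (y, eta, t, mu) := z in
  (((y, eta), (mu * coef_a y eta t, mu * coef_b y eta t)),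
   (curve y eta t, mu *: conormal y eta t)).

Definition canonical_relation : set (TsMM * TsM) := param @` param_dom.

Definition pi_M (c : TsMM * TsM) : TsM := c.2.

Definition pi_MM (c : TsMM * TsM) : TsMM := c.1.

(* T*M \ 0 in the local setting: the nonzero covectors conormal to the curves
   under consideration. *)
Definition cotangent_M : set TsM :=
  [set z | z.2 != 0 /\ exists y eta t,
     [/\ D (y, eta), times y eta t, z.1 = curve y eta t &
         (z.2 *m (velocity (curve y eta) t)^T) 0 0 = 0]].

Definition cotangent_MM : set TsMM := [set z | D z.1 /\ z.2 != 0].

Definition canonical_map : TsM -> TsMM :=
  pi_MM \o pinv canonical_relation pi_M.

Definition bolker : Prop :=
  set_inj canonical_relation pi_MM /\ immersion_on param_dom (pi_MM \o param).

Definition conjugate_at (y eta t1 t2 : R) : Prop :=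
  conjugate_along g gam (curve y eta t1) (velocity (curve y eta) t1) (t2 - t1).

Definition no_conjugate_points : Prop :=
  forall y eta t1 t2, D (y, eta) -> times y eta t1 -> times y eta t2 ->
    t1 < t2 -> ~ conjugate_at y eta t1 t2.

Definition covectors_related (a : R -> R -> R -> R) (y eta t1 t2 : R)
    (xi1 xi2 : E) : Prop :=
  exists mu : R, [/\ mu != 0,
    xi1 = (mu * a y eta t2) *: conormal y eta t1 &
    xi2 = (mu * a y eta t1) *: conormal y eta t2].

(* Condition (b) is the first alternative.  Since xi1 and xi2 are nonzero, it
   cannot hold if the coefficient a_1 of d/dy vanishes at both times, which does
   happen (a_1 depends on the coordinates (y, eta), and if it vanishes at one
   of two conjugate points then it vanishes at the other one).  In this case b_1
   vanishes at neither time, and the same relation holds with b_1 instead. *)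
Definition condition_b (y eta t1 t2 : R) (xi1 xi2 : E) : Prop :=
  covectors_related coef_a y eta t1 t2 xi1 xi2 \/
  [/\ coef_a y eta t1 = 0, coef_a y eta t2 = 0 &
      covectors_related coef_b y eta t1 t2 xi1 xi2].

Definition joined (z1 z2 : TsM) : Prop :=
  exists y eta t1 t2,
    [/\ [/\ D (y, eta), times y eta t1, times y eta t2 & t1 < t2],
        z1.1 = curve y eta t1, z2.1 = curve y eta t2,
        conjugate_at y eta t1 t2 &
        condition_b y eta t1 t2 z1.2 z2.2].

End CanonicalRelation.

(* Main.v *)
Require Import Defs.
From HB Require Import structures.
From mathcomp Require Import all_boot all_order all_algebra.
From mathcomp Require Import all_classical all_reals all_analysis.
From mathcomp Require Import ring lra.
(** The curves are parameterized by z = (y, eta, t), with position [pos z],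
    velocity [vel z] and conormal [cnormal z], and the canonical relation by
    (z, mu) with mu <> 0; in these parameters pi_M is
    [rel_M] : (z, mu) |-> (pos z, mu cnormal z), and pi_MM is
    [rel_MM] : (z, mu) |-> (y, eta, mu a, mu b).  Everything follows from
    three facts about the unit speed flow.

    First, z |-> (pos z, vel z) is an immersion ([phase_immersion]): the flow
    moves the time t to the time 0, where transversality to the hypersurface
    and regularity of the parameter eta give the claim.

    Second, the Wronskian a b' - a' b does not vanish ([wronskian]).  If
    (al, be) annihilates (a, b) and (a', b'), then the variation
    Z = al d/dy + be d/deta satisfies Z pos = k vel for some k, and Z - k d/dt
    fixes the position.  By the second equation, and by the symmetry of second
    derivatives, it changes the velocity by a vector without normal component;
    the unit speed condition removes the tangential component.  So Z - k d/dt
    is annihilated by the immersion above.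

    Hence both [rel_M] and [rel_MM] have invertible derivatives: the first one
    by the same two conditions on the variation of the velocity, the second one
    because its determinant is mu times the Wronskian.  By the inverse function
    theorem ([inverse_function]), proved from the contraction principle,
    both are local diffeomorphisms, and so is the canonical map, which is
    [rel_MM] composed with a local inverse of [rel_M] because pi_M is bijective
    on the canonical relation.

    Third, gamma(t2) is conjugate to gamma(t1) exactly when
    a(t1) b(t2) = a(t2) b(t1) ([conjugate_atE]): the variation
    b(t1) d/dy - a(t1) d/deta, corrected by a multiple of d/dt, fixes the point
    at time t1 and turns the velocity there, so that at time t2 it is a nonzero
    multiple of the derivative of the exponential map in the angle; its normal
    component there is b(t1) a(t2) - a(t1) b(t2).  Two covectors have the same
    image when they come from the same curve and (mu1 a(t1), mu1 b(t1)) equals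
    (mu2 a(t2), mu2 b(t2)), that is when (a, b) is proportional at both times,
    with the factors described by condition (b).  Without conjugate points this
    forces t1 = t2, and the local inverses glue. *)

Set Implicit Arguments.
Unset Strict Implicit.
Unset Printing Implicit Defensive.

Import Order.TTheory GRing.Theory Num.Theory.
Import numFieldNormedType.Exports.

Local Open Scope classical_set_scope.
Local Open Scope ring_scope.

(** * Smooth maps between normed spaces *)

Lemma pairP A B (p q : A * B) : p.1 = q.1 -> p.2 = q.2 -> p = q.
Proof. by case: p q => ? ? [? ?] /= -> ->. Qed.

Section FiniteOrder.
Context {R : realType}.

(** This is differentiability of order n.+1.  Peeling off the innermost derivative,
    instead of the outermost one, is what makes inductions on n apply to the
    derivatives of sums, products and compositions. *)
Fixpoint ndiff (V W : normedModType R) n (U : set V) (f : V -> W) : Prop :=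
  (forall x, U x -> differentiable f x) /\
  (if n is m.+1 then forall v, ndiff m U ('D_v f) else True).

Implicit Types V W Z : normedModType R.

Lemma ndiff_differentiable V W n (U : set V) (f : V -> W) x :
  ndiff n U f -> U x -> differentiable f x.
Proof. by case: n => [|n] /= [h _]; apply: h. Qed.

Lemma ndiffW V W n (U : set V) (f : V -> W) : ndiff n.+1 U f -> ndiff n U f.
Proof.
elim: n f => [|n IH] f /= [hf h]; first by [].
by split=> // v; apply: IH; apply: h.
Qed.

Lemma iter_derive_rcons V W vs v (f : V -> W) :
  iter_derive (rcons vs v) f = iter_derive vs ('D_v f).
Proof. by elim: vs => //= w vs ->. Qed.

Lemma smooth_onD V W (U : set V) (f : V -> W) v :
  smooth_on U f -> smooth_on U ('D_v f).
Proof. by move=> h vs x Ux; rewrite -iter_derive_rcons; apply: h. Qed.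

Lemma smooth_onP V W (U : set V) (f : V -> W) :
  smooth_on U f <-> forall n, ndiff n U f.
Proof.
split=> [h n|h vs].
  elim: n f h => [|n IH] f h /=; first by split=> // x; apply: (h [::]).
  split; first by move=> x; apply: (h [::]).
  by move=> v; apply/IH/smooth_onD.
have {h} : ndiff (size vs) U f by [].
elim/last_ind: vs f => [|vs v IH] f h x Ux /=.
  exact: ndiff_differentiable h Ux.
rewrite iter_derive_rcons; apply: IH => //.
by move: h; rewrite size_rcons => -[_]; apply.
Qed.

Lemma smooth_differentiable V W (U : set V) (f : V -> W) x :
  smooth_on U f -> U x -> differentiable f x.
Proof. by move=> h Ux; apply: (h [::]). Qed.

Lemma smooth_continuous V W (U : set V) (f : V -> W) x :
  smooth_on U f -> U x -> {for x, continuous f}.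
Proof. by move=> h Ux; apply/differentiable_continuous/(smooth_differentiable h). Qed.

Lemma smooth_onS V W (U U' : set V) (f : V -> W) :
  U' `<=` U -> smooth_on U f -> smooth_on U' f.
Proof. by move=> UU' h vs x /UU'; apply: h. Qed.

Lemma open_near V (U : set V) (x : V) : open U -> U x -> \forall y \near x, U y.
Proof. by move=> oU Ux; apply: open_nbhs_nbhs; split. Qed.

Lemma near_eq_diff V W (f g : V -> W) x :
  (\forall y \near x, f y = g y) -> differentiable f x ->
  differentiable g x /\ ('d g x : V -> W) = 'd f x.
Proof.
move=> fg df.
have cf : continuous ('d f x) by apply: diff_continuous.
have eg : g \o shift x = cst (g x) + 'd f x +o_ 0 id.
  have H := diff_locally df.
  apply/eqaddoP => e e0; move/eqaddoP: H => /(_ e e0).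
  have fg0 : \forall h \near (0 : V), f (h + x) = g (h + x).
    by move: fg; rewrite (near_shift 0) /= subr0.
  apply: filterS2 fg0 => h.
  by rewrite !fctE /= => ->; rewrite (nbhs_singleton fg).
have E : 'd g x = 'd f x :> (V -> W) by apply: diff_unique.
split=> //.
by apply/diff_locallyP; rewrite E.
Qed.

Lemma ndiff_ext V W n (U : set V) (f g : V -> W) : open U ->
  (forall x, U x -> f x = g x) -> ndiff n U f -> ndiff n U g.
Proof.
move=> oU; have nearfg f' g' x : (forall x, U x -> f' x = g' x) -> U x ->
    \forall y \near x, (f' y : W) = g' y.
  by move=> fg Ux; apply: filterS (open_near oU Ux) => y; apply: fg.
elim: n f g => [|n IH] f g fg /= [df h]; split=> //.
- by move=> x Ux; have [] := near_eq_diff (nearfg _ _ _ fg Ux) (df _ Ux).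
- by move=> x Ux; have [] := near_eq_diff (nearfg _ _ _ fg Ux) (df _ Ux).
- move=> v; apply: IH (h v) => x Ux.
  by apply: near_eq_derive; apply: nearfg.
Qed.

(** Iterated derivatives at x only see the germ at x, so that smooth extensions
    that change with the point suffice. *)
Lemma smooth_on_local V W (U : set V) (f : V -> W) :
  (forall x, U x -> exists (U' : set V) g,
     [/\ open U', U' x, smooth_on U' g & forall y, U' y -> f y = g y]) ->
  smooth_on U f.
Proof.
move=> H vs x Ux; have [U' [g [oU' U'x sg fg]]] := H x Ux.
suff /(_ vs x) : smooth_on U' f by apply.
apply/smooth_onP => n; have /smooth_onP/(_ n) := sg.
by apply: ndiff_ext => // y /fg.
Qed.

Lemma smooth_on_ext V W (U : set V) (f g : V -> W) : open U ->
  (forall x, U x -> f x = g x) -> smooth_on U f -> smooth_on U g.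
Proof.
by move=> oU fg sf; apply: smooth_on_local => x Ux; exists U, f; split=> // y /fg.
Qed.

Lemma ndiff_cst V W n (U : set V) (a : W) : ndiff n U (cst a : V -> W).
Proof.
elim: n a => [|n IH] a /=; split=> // v.
by rewrite (_ : 'D_v _ = cst 0) //; apply/funext => x; rewrite derive_cst.
Qed.

Lemma ndiff_linear V W n (U : set V) (l : {linear V -> W}) :
  continuous l -> ndiff n U l.
Proof.
move=> cl; have dl x : differentiable l x by apply: linear_differentiable.
case: n => [|n] /=; split=> // v.
rewrite (_ : 'D_v _ = cst (l v)); first exact: ndiff_cst.
by apply/funext => x; rewrite deriveE // diff_lin.
Qed.

Lemma ndiff_lincomp V W Z n (U : set V) (l : {linear W -> Z}) (f : V -> W) :
  open U -> continuous l -> ndiff n U f -> ndiff n U (l \o f).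
Proof.
move=> oU cl; have dl x : differentiable l x by apply: linear_differentiable.
have dc f' x : differentiable (f' : V -> W) x -> differentiable (l \o f') x.
  by move=> df'; apply: differentiable_comp.
elim: n f => [|n IH] f /= [df h]; split=> //.
- by move=> x /df; apply: dc.
- by move=> x /df; apply: dc.
move=> v; apply: ndiff_ext (IH _ (h v)) => // x /df dfx.
by rewrite (deriveE _ (dc _ _ dfx)) (diff_comp dfx (dl _)) (diff_lin _ cl) /= (deriveE _ dfx).
Qed.

Lemma ndiffD V W n (U : set V) (f g : V -> W) :
  open U -> ndiff n U f -> ndiff n U g -> ndiff n U (fun x => f x + g x).
Proof.
move=> oU; have dD f' g' x : differentiable (f' : V -> W) x ->
    differentiable (g' : V -> W) x -> differentiable (fun x => f' x + g' x) x.
  by move=> ? ?; apply: differentiableD.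
elim: n f g => [|n IH] f g /= [df hf] [dg hg]; split=> //;
  try by (move=> x Ux; apply: dD; [apply: df|apply: dg]).
move=> v; apply: ndiff_ext (IH _ _ (hf v) (hg v)) => // x Ux.
by rewrite -[RHS]/('D_v (f + g) x) deriveD //; apply: diff_derivable; [apply: df|apply: dg].
Qed.

(** Recorded so that the derivative of a bilinear map yields the Leibniz rule for
    [k x *: f x]. *)
Lemma scale_is_bilinear W :
  bilinear_for
    (GRing.Scale.Law.clone _ _ *:%R _) (GRing.Scale.Law.clone _ _ *:%R _)
    (@GRing.scale R W : R -> W -> W).
Proof.
split=> [u'|u] a x y /=.
- by rewrite scalerDl scalerA.
- by rewrite scalerDr !scalerA [u * a]mulrC.
Qed.

HB.instance Definition _ W := bilinear_isBilinear.Build R R W W _ _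
  (@GRing.scale R W : R -> W -> W) (scale_is_bilinear W).

Lemma differentiable_scale V W (k : V -> R) (f : V -> W) x :
  differentiable k x -> differentiable f x ->
  differentiable (fun z => k z *: f z) x /\
  forall v, 'd (fun z => k z *: f z) x v = 'd k x v *: f x + k x *: 'd f x v.
Proof.
move=> dk df; pose S := (@GRing.scale R W : R -> W -> W).
have cS : continuous (fun p : R * W => S p.1 p.2) by apply: scale_continuous.
have dp := differentiable_pair dk df.
have dS p : differentiable (fun p : R * W => S p.1 p.2) p.
  exact: differentiable_bilin.
have -> : (fun z => k z *: f z) = (fun p : R * W => S p.1 p.2) \o (fun z => (k z, f z)).
  by [].
split; first exact: differentiable_comp.
by move=> v; rewrite diff_comp //= diff_bilin // diff_pair //= addrC.
Qed.

Lemma ndiff_scale V W n (U : set V) (k : V -> R) (f : V -> W) :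
  open U -> ndiff n U k -> ndiff n U f -> ndiff n U (fun x => k x *: f x).
Proof.
move=> oU; elim: n k f => [|n IH] k f /= [dk hk] [df hf]; split=> //;
  try by (move=> x Ux; have [] := differentiable_scale (dk x Ux) (df x Ux)).
move=> v.
have nk : ndiff n U k by apply: ndiffW.
have nf : ndiff n U f by apply: ndiffW.
apply: ndiff_ext (ndiffD oU (IH _ _ (hk v) nf) (IH _ _ nk (hf v))) => // x Ux.
have [d E] := differentiable_scale (dk x Ux) (df x Ux).
by rewrite (deriveE _ d) E (deriveE _ (dk x Ux)) (deriveE _ (df x Ux)).
Qed.

Lemma ndiff_sum V W n (I : Type) (r : seq I) (P : pred I) (U : set V) (f : I -> V -> W) :
  open U -> (forall i, ndiff n U (f i)) ->
  ndiff n U (fun x => \sum_(i <- r | P i) f i x).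
Proof.
move=> oU nf; rewrite (_ : (fun x => _) = \sum_(i <- r | P i) f i); last first.
  by apply/funext => x; rewrite fct_sumE.
elim/big_ind: _ => [|g h ng nh|i _]; [exact: ndiff_cst|exact: ndiffD|exact: nf].
Qed.

Lemma ndiff_prod V n (I : Type) (r : seq I) (P : pred I) (U : set V) (f : I -> V -> R) :
  open U -> (forall i, ndiff n U (f i)) ->
  ndiff n U (fun x => \prod_(i <- r | P i) f i x).
Proof.
move=> oU nf; elim: r => [|i r IH].
  rewrite (_ : (fun x => _) = cst 1); first exact: ndiff_cst.
  by apply/funext => x; rewrite big_nil.
case Pi : (P i); last first.
  by apply: ndiff_ext IH => // x _; rewrite big_cons Pi.
apply: ndiff_ext (ndiff_scale oU (nf i) IH) => // x _.
by rewrite big_cons Pi.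
Qed.

(** Induction is possible because (1/f)' = - f' (1/f) (1/f) involves only 1/f of
    one order less. *)
Lemma ndiffV V n (U : set V) (f : V -> R) : open U ->
  (forall x, U x -> f x != 0) -> ndiff n U f -> ndiff n U (fun x => (f x)^-1).
Proof.
move=> oU f0; elim: n => [|n IH] nf.
  by split=> // x Ux; apply: differentiableV; [case: nf => + _; apply|apply: f0].
have nf' := ndiffW nf; have nV := IH nf'; move: nf => /= [df hf].
have dV x : U x -> differentiable (fun y => (f y)^-1) x.
  by move=> Ux; apply: differentiableV; [apply: df|apply: f0].
split=> // v.
have c1 : ndiff n U (cst (-1) : V -> R) by apply: ndiff_cst.
have nD := ndiff_scale oU c1 (ndiff_scale oU nV (ndiff_scale oU nV (hf v))).
apply: ndiff_ext nD => // x Ux /=.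
rewrite deriveV //; [|exact: f0|exact/diff_derivable/df].
by rewrite /cst /= !scalerA mulN1r expr2 invfM mulNr.
Qed.

(** As for the inverse: (sqrt f)' = f' / (2 sqrt f). *)
Lemma ndiff_sqrt V n (U : set V) (f : V -> R) : open U ->
  (forall x, U x -> 0 < f x) -> ndiff n U f -> ndiff n U (fun x => Num.sqrt (f x)).
Proof.
move=> oU f0; have ds x : U x -> differentiable (@Num.sqrt R) (f x).
  move=> Ux; apply/derivable1_diffP.
  by have [] := is_derive1_sqrt (f0 x Ux).
have dsf x : ndiff 0 U f -> U x -> differentiable (fun x => Num.sqrt (f x)) x.
  move=> [df _] Ux; rewrite (_ : (fun x => _) = @Num.sqrt R \o f) //.
  by apply: differentiable_comp; [apply: df|apply: ds].
elim: n => [|n IH] nf; first by split=> // x Ux; apply: dsf.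
have nf' := ndiffW nf; have nS := IH nf'; move: nf => /= [df hf].
have df0 : ndiff 0 U f by split.
split=> [x Ux|v]; first exact: dsf.
have nV : ndiff n U (fun x => (Num.sqrt (f x))^-1).
  by apply: ndiffV nS => // x /f0 ?; rewrite gt_eqF // sqrtr_gt0.
have c2 : ndiff n U (cst 2^-1 : V -> R) by apply: ndiff_cst.
have nD := ndiff_scale oU c2 (ndiff_scale oU nV (hf v)).
apply: ndiff_ext nD => // x Ux /=.
rewrite (deriveE _ (dsf _ df0 Ux)) (_ : (fun x => Num.sqrt (f x)) = @Num.sqrt R \o f) //.
rewrite (diff_comp (df _ Ux) (ds _ Ux)) (diff1E (ds _ Ux)) /=.
have [_ e] := is_derive1_sqrt (f0 x Ux).
by rewrite derive1E e (deriveE _ (df _ Ux)) /cst /= /GRing.scale /= invfM [RHS]mulrC mulrA.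
Qed.

(** Finite dimension is carried by explicit coordinates because the spaces at
    hand are iterated products of R and R^2, for which the chain rule and the
    inverse function theorem are reduced to row vectors. *)
Record coords n V := Coords {
  toR : {linear V -> 'rV[R]_n};
  ofR : {linear 'rV[R]_n -> V};
  toR_cont : continuous toR;
  ofR_cont : continuous ofR;
  toRK : cancel toR ofR;
  ofRK : cancel ofR toR }.

Definition basis n V (c : coords n V) (i : 'I_n) : V := ofR c (delta_mx 0 i).

Lemma coords_sum n V (c : coords n V) (w : V) :
  w = \sum_i toR c w 0 i *: basis c i.
Proof.
rewrite -{1}(toRK c w) {1}(row_sum_delta (toR c w)) linear_sum.
by apply: eq_bigr => i _; rewrite linearZ.
Qed.

Definition mxentry m n (i : 'I_m) (j : 'I_n) (A : 'M[R]_(m, n)) : R := A i j.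

Lemma mxentry_linear m n i j : linear (@mxentry m n i j).
Proof. by move=> a A B; rewrite /mxentry !mxE. Qed.

HB.instance Definition _ m n i j := GRing.isLinear.Build R 'M[R]_(m, n) R _
  (@mxentry m n i j) (@mxentry_linear m n i j).

Lemma ndiff_entry V m n k (U : set V) (f : V -> 'M[R]_(m, n)) i j :
  open U -> ndiff k U f -> ndiff k U (fun x => f x i j).
Proof.
move=> oU; apply: (ndiff_lincomp (l := mxentry i j)) => //.
exact: coord_continuous.
Qed.

Lemma ndiff_matrix V m n k (U : set V) (f : V -> 'M[R]_(m, n)) :
  open U -> (forall i j, ndiff k U (fun x => f x i j)) -> ndiff k U f.
Proof.
move=> oU nf.
have nS : ndiff k U (fun x => \sum_i \sum_j f x i j *: delta_mx i j).
  apply: ndiff_sum => // i; apply: ndiff_sum => // j.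
  by apply: ndiff_scale => //; apply: ndiff_cst.
by apply: ndiff_ext nS => // x _; rewrite -matrix_sum_delta.
Qed.

(** In a basis, the derivatives of h o f are sums of products of derivatives of f
    with compositions of derivatives of h, which have one order less. *)
Lemma ndiff_comp k V W Z n (c : coords k W) (U : set V) (U' : set W)
    (f : V -> W) (h : W -> Z) : open U -> (forall x, U x -> U' (f x)) ->
  ndiff n U f -> ndiff n U' h -> ndiff n U (h \o f).
Proof.
move=> oU UU'; elim: n f h UU' => [|n IH] f h UU' nf nh.
  case: nf nh => df _ [dh _]; split=> // x Ux.
  by apply: differentiable_comp; [apply: df|apply/dh/UU'].
have nf' := ndiffW nf; have nh' := ndiffW nh.
move: nf nh => [df hf] [dh hh].
have dc x : U x -> differentiable (h \o f) x.
  by move=> Ux; apply: differentiable_comp; [apply: df|apply/dh/UU'].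
split=> // v.
have nS : ndiff n U (fun x => \sum_i toR c ('D_v f x) 0 i *:
    ('D_(basis c i) h \o f) x).
  apply: ndiff_sum => // i; apply: ndiff_scale => //.
    apply: ndiff_entry => //; apply: (ndiff_lincomp oU (@toR_cont _ _ c)).
    exact: hf.
  exact: (IH _ _ UU' nf' (hh _)).
apply: ndiff_ext nS => // x Ux.
rewrite (deriveE _ (dc _ Ux)) (diff_comp (df _ Ux) (dh _ (UU' _ Ux))) /=.
rewrite -(deriveE _ (df _ Ux)) [in RHS](coords_sum c ('D_v f x)) linear_sum.
by apply: eq_bigr => i _; rewrite linearZ -(deriveE _ (dh _ (UU' _ Ux))).
Qed.

Lemma smooth_comp k V W Z (c : coords k W) (U : set V) (U' : set W)
    (f : V -> W) (h : W -> Z) : open U -> (forall x, U x -> U' (f x)) ->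
  smooth_on U f -> smooth_on U' h -> smooth_on U (h \o f).
Proof.
move=> oU UU' /smooth_onP sf /smooth_onP sh; apply/smooth_onP => n.
exact: (ndiff_comp c oU UU').
Qed.

Lemma smooth_cst V W (U : set V) (a : W) : smooth_on U (fun=> a).
Proof. by apply/smooth_onP => n; apply: ndiff_cst. Qed.

Lemma smooth_linear V W (U : set V) (l : {linear V -> W}) :
  continuous l -> smooth_on U l.
Proof. by move=> cl; apply/smooth_onP => n; apply: ndiff_linear. Qed.

Lemma smooth_lincomp V W Z (U : set V) (l : {linear W -> Z}) (f : V -> W) :
  open U -> continuous l -> smooth_on U f -> smooth_on U (l \o f).
Proof.
by move=> oU cl /smooth_onP sf; apply/smooth_onP => n; apply: ndiff_lincomp.
Qed.

Lemma smoothD V W (U : set V) (f g : V -> W) : open U ->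
  smooth_on U f -> smooth_on U g -> smooth_on U (fun x => f x + g x).
Proof.
by move=> oU /smooth_onP sf /smooth_onP sg; apply/smooth_onP => n; apply: ndiffD.
Qed.

Lemma smooth_scale V W (U : set V) (k : V -> R) (f : V -> W) : open U ->
  smooth_on U k -> smooth_on U f -> smooth_on U (fun x => k x *: f x).
Proof.
by move=> oU /smooth_onP sf /smooth_onP sg; apply/smooth_onP => n; apply: ndiff_scale.
Qed.

Lemma smoothM V (U : set V) (k f : V -> R) : open U ->
  smooth_on U k -> smooth_on U f -> smooth_on U (fun x => k x * f x).
Proof. exact: smooth_scale. Qed.

Lemma smoothN V W (U : set V) (f : V -> W) : open U ->
  smooth_on U f -> smooth_on U (fun x => - f x).
Proof.
have c1 : smooth_on U (fun=> -1 : R) by apply: smooth_cst.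
move=> oU sf; apply: smooth_on_ext (smooth_scale oU c1 sf) => //.
by move=> x _; rewrite scaleN1r.
Qed.

Lemma smooth_sqrt V (U : set V) (f : V -> R) : open U ->
  (forall x, U x -> 0 < f x) -> smooth_on U f ->
  smooth_on U (fun x => Num.sqrt (f x)).
Proof.
by move=> oU f0 /smooth_onP sf; apply/smooth_onP => n; apply: ndiff_sqrt.
Qed.

Lemma smooth_entry V m n (U : set V) (f : V -> 'M[R]_(m, n)) i j :
  open U -> smooth_on U f -> smooth_on U (fun x => f x i j).
Proof.
by move=> oU /smooth_onP sf; apply/smooth_onP => k; apply: ndiff_entry.
Qed.

Lemma smooth_matrix V m n (U : set V) (f : V -> 'M[R]_(m, n)) : open U ->
  (forall i j, smooth_on U (fun x => f x i j)) -> smooth_on U f.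
Proof.
move=> oU sf; apply/smooth_onP => k; apply: ndiff_matrix => // i j.
by have /smooth_onP := sf i j; apply.
Qed.

Lemma ndiff_pair V W Z n (U : set V) (f : V -> W) (g : V -> Z) : open U ->
  ndiff n U f -> ndiff n U g -> ndiff n U (fun x => (f x, g x)).
Proof.
move=> oU; have dp f' g' x : differentiable (f' : V -> W) x ->
    differentiable (g' : V -> Z) x -> differentiable (fun x => (f' x, g' x)) x.
  by move=> ? ?; apply: differentiable_pair.
elim: n f g => [|n IH] f g /= [df hf] [dg hg]; split=> //;
  try by (move=> x Ux; apply: dp; [apply: df|apply: dg]).
move=> v; apply: ndiff_ext (IH _ _ (hf v) (hg v)) => // x Ux.
rewrite (deriveE _ (dp _ _ _ (df _ Ux) (dg _ Ux))) diff_pair /=; last 2 first.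
- exact: df.
- exact: dg.
by rewrite -(deriveE _ (df _ Ux)) -(deriveE _ (dg _ Ux)).
Qed.

Lemma smooth_pair V W Z (U : set V) (f : V -> W) (g : V -> Z) : open U ->
  smooth_on U f -> smooth_on U g -> smooth_on U (fun x => (f x, g x)).
Proof.
by move=> oU /smooth_onP sf /smooth_onP sg; apply/smooth_onP => n; apply: ndiff_pair.
Qed.

Lemma fst_continuous V W : continuous (fst : V * W -> V).
Proof. by move=> p; apply: cvg_fst. Qed.

Lemma snd_continuous V W : continuous (snd : V * W -> W).
Proof. by move=> p; apply: cvg_snd. Qed.

Lemma smooth_fst V W Z (U : set V) (f : V -> W * Z) : open U ->
  smooth_on U f -> smooth_on U (fun x => (f x).1).
Proof. by move=> oU; apply: (smooth_lincomp (l := fst)) => //; apply: fst_continuous. Qed.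

Lemma smooth_snd V W Z (U : set V) (f : V -> W * Z) : open U ->
  smooth_on U f -> smooth_on U (fun x => (f x).2).
Proof. by move=> oU; apply: (smooth_lincomp (l := snd)) => //; apply: snd_continuous. Qed.

Lemma smooth_id V (U : set V) : smooth_on U id.
Proof. by apply: (@smooth_linear _ _ _ idfun) => x. Qed.

Lemma rV_linear_continuous n W (l : {linear 'rV[R]_n -> W}) : continuous l.
Proof.
rewrite (_ : (l : _ -> _) = fun A => \sum_i A 0 i *: l (delta_mx 0 i)); last first.
  apply/funext => A; rewrite {1}(row_sum_delta A) linear_sum.
  by apply: eq_bigr => i _; rewrite linearZ.
apply: continuous_big => [|i _ A]; first exact: add_continuous.
by apply: continuousZr_tmp; exact: (@coord_continuous R 1 n 0 i A).
Qed.

Lemma idfun_coords n : continuous (@idfun 'rV[R]_n). Proof. by move=> A P. Qed.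

Definition coords_rV n : coords n 'rV[R]_n :=
  @Coords n _ idfun idfun (@idfun_coords n) (@idfun_coords n)
    (fun=> erefl) (fun=> erefl).

Definition rowR (x : R) : 'rV[R]_1 := x *: 1%:M.

Lemma rowR_linear : linear rowR.
Proof. by move=> a x y; rewrite /rowR scalerDl scalerA. Qed.
HB.instance Definition _ := GRing.isLinear.Build R R 'rV[R]_1 _ rowR rowR_linear.

Lemma rowR_continuous : continuous rowR.
Proof. by move=> x; apply: scalel_continuous. Qed.

Lemma rowRK : cancel rowR (@mxentry 1 1 0 0).
Proof. by move=> x; rewrite /mxentry /rowR !mxE mulr1. Qed.

Lemma mxentry11K : cancel (@mxentry 1 1 0 0) rowR.
Proof. by move=> A; apply/rowP => i; rewrite !mxE ord1 mulr1. Qed.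

Definition coords_R : coords 1 R :=
  @Coords _ _ rowR (mxentry 0 0) rowR_continuous
    (@coord_continuous _ _ _ 0 0) rowRK mxentry11K.

Section Product.
Context {V W : normedModType R} {n m : nat} (c : coords n V) (d : coords m W).

Definition prod_toR (p : V * W) : 'rV[R]_(n + m) :=
  toR c p.1 *m row_mx 1%:M 0 + toR d p.2 *m row_mx 0 1%:M.

Definition prod_ofR (A : 'rV[R]_(n + m)) : V * W :=
  (ofR c (A *m col_mx 1%:M 0), ofR d (A *m col_mx 0 1%:M)).

Lemma prod_toR_linear : linear prod_toR.
Proof.
move=> a p q; rewrite /prod_toR /= !linearP /= !mulmxDl -!scalemxAl scalerDr.
by rewrite addrACA.
Qed.
HB.instance Definition _ := GRing.isLinear.Build _ _ _ _ _ prod_toR_linear.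

Lemma prod_ofR_linear : linear prod_ofR.
Proof.
move=> a A B; rewrite /prod_ofR !mulmxDl -!scalemxAl !linearP.
by apply/pair_equal_spec.
Qed.
HB.instance Definition _ := GRing.isLinear.Build _ _ _ _ _ prod_ofR_linear.

Lemma prod_toR_continuous : continuous prod_toR.
Proof.
move=> p; apply: cvgD.
  apply: (@continuous_comp _ _ _ (fun q => toR c q.1) (mulmxr (row_mx 1%:M 0))).
    apply: (@continuous_comp _ _ _ fst); [exact: cvg_fst|exact: toR_cont].
  exact: rV_linear_continuous.
apply: (@continuous_comp _ _ _ (fun q => toR d q.2) (mulmxr (row_mx 0 1%:M))).
  apply: (@continuous_comp _ _ _ snd); [exact: cvg_snd|exact: toR_cont].
exact: rV_linear_continuous.
Qed.

Lemma prod_toRK : cancel prod_toR prod_ofR.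
Proof.
move=> [v w]; rewrite /prod_ofR /prod_toR /= !mulmxDl -!mulmxA !mul_row_col.
by rewrite !(mulmx0, mul0mx, mulmx1, addr0, add0r) !toRK.
Qed.

Lemma prod_ofRK : cancel prod_ofR prod_toR.
Proof.
move=> A; rewrite /prod_ofR /prod_toR /= !ofRK -!mulmxA -mulmxDr !mul_col_row.
rewrite !(mulmx0, mul0mx, mulmx1) add_block_mx !(add0r, addr0).
by rewrite -scalar_mx_block mulmx1.
Qed.

Definition coords_prod : coords (n + m) (V * W)%type :=
  @Coords _ _ prod_toR prod_ofR prod_toR_continuous
    (@rV_linear_continuous _ _ prod_ofR) prod_toRK prod_ofRK.

End Product.

Section Slices.
Context {V W : normedModType R}.

(** The hypothesis says that c is the line through c t with direction v; stated
    in this form it also covers curves that move one component of a tuple. *)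
Lemma derive1_slice (f : V -> W) (c : R -> V) (t : R) v :
  (forall h, c (h + t) = h *: v + c t) -> derive1 (f \o c) t = 'D_v f (c t).
Proof.
move=> Ec; rewrite /derive1 /derive; congr (lim _).
suff -> : (fun h : R => h^-1 *: ((f \o c) (h + t) - (f \o c) t)) =
          (fun h : R => h^-1 *: ((f \o shift (c t)) (h *: v) - f (c t))) by [].
by apply/funext => h /=; rewrite Ec.
Qed.

Lemma is_derive_line (f : V -> W) (x v : V) (s : R) :
  differentiable f (x + s *: v) ->
  is_derive s 1 (fun s => f (x + s *: v)) ('D_v f (x + s *: v)).
Proof.
move=> df; set c := fun s : R => x + s *: v.
have dc : is_diff s c (fun h => h *: v).
  have := is_diffD (is_diff_cst x s) (is_diff_scalel s v).
  by rewrite add0r.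
have dfc : differentiable (f \o c) s by apply: differentiable_comp => //; case: dc.
apply: DeriveDef; first exact/diff_derivable.
rewrite (deriveE _ dfc) diff_comp //=.
by case: dc => _ ->; rewrite scale1r (deriveE _ df).
Qed.

End Slices.

(** Two applications of the mean value theorem, in the direction u and then in
    the direction v; the left-hand side is symmetric in u and v. *)
Lemma double_difference V (U : set V) (f : V -> R) (x u v : V) (h : R) :
  0 < h -> smooth_on U f ->
  (forall s t, 0 <= s <= h -> 0 <= t <= h -> U (x + s *: u + t *: v)) ->
  exists s t, [/\ 0 <= s <= h, 0 <= t <= h &
    f (x + h *: u + h *: v) - f (x + h *: u) - f (x + h *: v) + f x =
    h ^+ 2 * 'D_v ('D_u f) (x + s *: u + t *: v)].
Proof.
move=> h0 sf HU.
have df y : U y -> differentiable f y by apply: smooth_differentiable.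
have dDf y : U y -> differentiable ('D_u f) y.
  by apply/smooth_differentiable/smooth_onD.
pose F (s : R) := f (x + h *: v + s *: u) - f (x + s *: u).
pose dF (s : R) := 'D_u f (x + h *: v + s *: u) - 'D_u f (x + s *: u).
have hh : 0 <= h <= h by rewrite lexx ltW.
have h00 : 0 <= (0 : R) <= h by rewrite lexx ltW.
have isdF (s : R) : 0 <= s <= h -> is_derive s 1 F (dF s).
  move=> sh; apply: is_deriveB; apply: is_derive_line; apply: df.
    by rewrite addrAC; apply: HU.
  by rewrite -[_ + _]addr0 -(scale0r v); apply: HU.
have [s sh Es] : exists2 s, 0 <= s <= h & F h - F 0 = dF s * h.
  have [|||s] := @MVT_segment R F dF 0 h; first exact: ltW.
  - move=> s /[!in_itv]/= /andP[s0 s1]; apply: isdF; by rewrite !ltW.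
  - apply: derivable_within_continuous => s /[!in_itv]/= sh.
    by have [] := isdF _ sh.
  - by rewrite in_itv subr0 => sh E; exists s.
pose Gf (t : R) := 'D_u f (x + s *: u + t *: v).
have isdG (t : R) : 0 <= t <= h -> is_derive t 1 Gf ('D_v ('D_u f) (x + s *: u + t *: v)).
  by move=> th; apply: is_derive_line; apply/dDf/HU.
have [t th Et] : exists2 t, 0 <= t <= h &
    Gf h - Gf 0 = 'D_v ('D_u f) (x + s *: u + t *: v) * h.
  have [|||t] := @MVT_segment R Gf
    (fun t => 'D_v ('D_u f) (x + s *: u + t *: v)) 0 h; first exact: ltW.
  - move=> t /[!in_itv]/= /andP[t0 t1]; apply: isdG; by rewrite !ltW.
  - apply: derivable_within_continuous => t /[!in_itv]/= th.
    by have [] := isdG _ th.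
  - by rewrite in_itv subr0 => th E; exists t.
exists s, t; split=> //.
have EdF : dF s = Gf h - Gf 0.
  by rewrite /dF /Gf scale0r addr0 [x + h *: v + _]addrAC.
rewrite expr2 -mulrA [h * 'D_v _ _]mulrC -Et -EdF mulrC -Es /F !scale0r !addr0.
rewrite [x + h *: v + h *: u]addrAC; ring.
Qed.

Lemma segment_near V (P : set V) (x u v : V) : (\forall y \near x, P y) ->
  exists2 h : R, 0 < h &
    forall s t, 0 <= s <= h -> 0 <= t <= h -> P (x + s *: u + t *: v).
Proof.
move=> /nbhs_ballP[e /= e0 He].
(* Adding 1 keeps the denominator positive when u = v = 0. *)
exists (e / (`|u| + `|v| + 1)); first by rewrite divr_gt0 // ltr_wpDl // addr_ge0.
move=> s t /andP[s0 sh] /andP[t0 th]; apply: He.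
rewrite -ball_normE /= -addrA opprD addNKr normrN.
apply: le_lt_trans (ler_normD _ _) _; rewrite !normrZ !ger0_norm //.
have d0 : 0 < `|u| + `|v| + 1 by rewrite ltr_wpDl // addr_ge0.
apply: (@le_lt_trans _ _ (e / (`|u| + `|v| + 1) * (`|u| + `|v|))).
  by rewrite mulrDr lerD // ler_wpM2r.
by rewrite mulrAC ltr_pdivrMr // ltr_pM2l // ltrDl.
Qed.

Lemma close_absurd (a b c : R) :
  `|a - c| < `|a - b| / 2 -> `|b - c| < `|a - b| / 2 -> False.
Proof.
move=> C1 C2; suff : `|a - b| < `|a - b| by rewrite ltxx.
rewrite {2}[`|a - b|]splitr; apply: le_lt_trans (ltrD C1 C2).
by rewrite [`|b - c|]distrC -[a - b](subrKA c) ler_normD.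
Qed.

(** Both mixed derivatives are limits of the same double difference quotient, at
    points that tend to x. *)
Lemma derive_comm_scalar V (U : set V) (f : V -> R) (x u v : V) : open U ->
  smooth_on U f -> U x -> 'D_v ('D_u f) x = 'D_u ('D_v f) x.
Proof.
move=> oU sf Ux; apply/eqP; rewrite -subr_eq0 -normr_le0 leNgt.
apply/negP; set d := `|_| => d0.
have cont w1 w2 : \forall y \near x,
    `|'D_w1 ('D_w2 f) x - 'D_w1 ('D_w2 f) y| < d / 2.
  have /cvgrPdist_lt := smooth_continuous (smooth_onD w1 (smooth_onD w2 sf)) Ux.
  by apply; rewrite divr_gt0.
have oUx := open_near oU Ux.
have [h h0 H] := segment_near u v
  (filterI oUx (filterI (cont u v) (cont v u))).
have [|s1 [t1 [s1h t1h E1]]] := double_difference h0 sf (x := x) (u := u) (v := v).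
  by move=> s t sh th; have [] := H s t sh th.
have [|t2 [s2 [t2h s2h E2]]] := double_difference h0 sf (x := x) (u := v) (v := u).
  by move=> s t sh th; rewrite addrAC; have [] := H t s th sh.
have [_ [_ C1]] := H _ _ s1h t1h.
have [_ [C2 _]] := H _ _ s2h t2h.
rewrite [x + h *: v + _]addrAC [_ - f _ - f _]addrAC [x + t2 *: v + _]addrAC in E2.
have hn : h ^+ 2 != 0 by rewrite expf_neq0 // gt_eqF.
have E := mulfI hn (etrans (esym E1) E2).
by move: C1 C2; rewrite E => C1 C2; apply: (close_absurd C1 C2).
Qed.

Lemma derive_lincomp V W Z (l : {linear W -> Z}) (f : V -> W) x v :
  continuous l -> differentiable f x -> 'D_v (l \o f) x = l ('D_v f x).
Proof.
move=> cl df; have dl y : differentiable l y by apply: linear_differentiable.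
rewrite (deriveE _ (differentiable_comp df (dl _))) (diff_comp df (dl _)).
by rewrite (diff_lin _ cl) /= (deriveE _ df).
Qed.

Lemma derive_comm V n (U : set V) (f : V -> 'rV[R]_n) (x u v : V) : open U ->
  smooth_on U f -> U x -> 'D_v ('D_u f) x = 'D_u ('D_v f) x.
Proof.
move=> oU sf Ux; apply/rowP => j.
have ce : continuous (@mxentry 1 n 0 j) by move=> A; apply: coord_continuous.
have E w1 w2 : 'D_w1 ('D_w2 f) x 0 j = 'D_w1 ('D_w2 (mxentry 0 j \o f)) x.
  have dDf : differentiable ('D_w2 f) x.
    by apply: (smooth_differentiable (smooth_onD w2 sf)).
  rewrite -[LHS]/(mxentry 0 j _) -(derive_lincomp _ ce dDf).
  apply: near_eq_derive; apply: filterS (open_near oU Ux) => y Uy.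
  by rewrite (derive_lincomp _ ce) //; apply: smooth_differentiable sf Uy.
have sc : smooth_on U (mxentry 0 j \o f) by apply: smooth_lincomp.
exact: etrans (E v u) (etrans (derive_comm_scalar u v oU sc Ux) (esym (E u v))).
Qed.

End FiniteOrder.

(** * The inverse function theorem *)

HB.instance Definition _ (R : realType) m n := Complete.on 'M[R]_(m, n).

Section InverseFunction.
Context {R : realType}.
Implicit Types V W : normedModType R.

Lemma rV_norm_le n (v : 'rV[R]_n) (c : R) :
  0 <= c -> (forall i, `|v 0 i| <= c) -> `|v| <= c.
Proof.
move=> c0 H; have [/eqP E|/mx_norm_neq0[[i j] E]] := boolP (mx_norm v == 0).
  by rewrite /Num.norm /= E.
by rewrite /Num.norm /= E ord1; apply: H.
Qed.

Lemma rV_entry_le n (v : 'rV[R]_n) i : `|v 0 i| <= `|v|.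
Proof.
rewrite [leRHS]/Num.norm /= mx_normrE.
exact: (le_bigmax _ (fun ij => `|v ij.1 ij.2|) (0, i)).
Qed.

Lemma ndiff_det V m k (U : set V) (A : V -> 'M[R]_m) : open U ->
  (forall i j, ndiff k U (fun x => A x i j)) -> ndiff k U (fun x => \det (A x)).
Proof.
move=> oU nA; apply: ndiff_sum => // s; apply: ndiff_scale => //.
  exact: ndiff_cst.
exact: ndiff_prod.
Qed.

(** By Cramer's rule the entries of the inverse are polynomials in those of A,
    divided by the determinant. *)
Lemma ndiff_invmx V m k (U : set V) (A : V -> 'M[R]_m) : open U ->
  (forall x, U x -> A x \in unitmx) -> ndiff k U A ->
  ndiff k U (fun x => invmx (A x)).
Proof.
move=> oU uA nA; have nAij i j : ndiff k U (fun x => A x i j).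
  exact: ndiff_entry.
have nadj : ndiff k U (fun x => (\det (A x))^-1 *: \adj (A x)).
  apply: ndiff_scale => //.
    apply: ndiffV; [by []| |exact: ndiff_det].
    by move=> x /uA; rewrite unitmxE unitfE.
  apply: ndiff_matrix => // i j.
  apply: (@ndiff_ext _ _ _ _ _ (fun x => (-1) ^+ (j + i) *
      \det (row' j (col' i (A x))))) => //.
    by move=> x _; rewrite mxE.
  apply: ndiff_scale => //; first exact: ndiff_cst.
  apply: ndiff_det => // a b.
  by apply: ndiff_ext (nAij (lift j a) (lift i b)) => // x _; rewrite !mxE.
by apply: ndiff_ext nadj => // x Ux; rewrite /invmx uA.
Qed.

Lemma jacobian_entry n m (f : 'rV[R]_n -> 'rV[R]_m) x i j :
  differentiable f x -> jacobian f x i j = 'D_(delta_mx 0 i) f x 0 j.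
Proof. by move=> df; rewrite (deriveEjacobian _ df) -rowE [RHS]mxE. Qed.

Lemma derive_sum_basis n W (f : 'rV[R]_n -> W) x v :
  differentiable f x -> 'D_v f x = \sum_i v 0 i *: 'D_(delta_mx 0 i) f x.
Proof.
move=> df; rewrite (deriveE _ df) {1}(row_sum_delta v) linear_sum.
by apply: eq_bigr => i _; rewrite linearZ (deriveE _ df).
Qed.

(** Continuity of the finitely many partial derivatives at P.  The bound is a
    sum of n terms; the n.+1 in the constant [K] also covers n = 0. *)
Lemma small_derivative n (U : set 'rV[R]_n) (phi : 'rV[R]_n -> 'rV[R]_n) P :
  open U -> smooth_on U phi -> U P -> (forall v, 'D_v phi P = 0) ->
  exists2 r : R, 0 < r & forall z, `|P - z| <= r ->
    U z /\ forall v, `|'D_v phi z| <= 2^-1 * `|v|.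
Proof.
move=> oU sphi UP D0; pose K : R := (2 * n.+1%:R)^-1.
have K0 : 0 < K by rewrite invr_gt0 mulr_gt0.
have near_i : \forall z \near P, forall i : 'I_n,
    `|'D_(delta_mx 0 i) phi z| < K.
  apply: (@filter_forall _ _ (fun i z => `|'D_(delta_mx 0 i) phi z| < K)
    (nbhs P) (nbhs_filter P)) => i.
  have /cvgrPdist_lt/(_ _ K0) := smooth_continuous
    (smooth_onD (delta_mx 0 i) sphi) UP.
  by apply: filterS => z; rewrite D0 sub0r normrN.
have nI := @filterI _ (nbhs P) (nbhs_filter P) _ _ (open_near oU UP) near_i.
have /nbhs_ballP[e /= e0 He] := nI.
exists (e / 2); first by rewrite divr_gt0.
move=> z Pz; have [Uz Dz] : (U `&` (fun z => forall i : 'I_n,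
    `|'D_(delta_mx 0 i) phi z| < K)) z.
  apply: He; rewrite -ball_normE /=; apply: le_lt_trans Pz _.
  by rewrite ltr_pdivrMr // ltr_pMr // ltr1n.
split=> // v; rewrite derive_sum_basis; last exact: smooth_differentiable sphi Uz.
apply: le_trans (ler_norm_sum _ _ _) _.
apply: (@le_trans _ _ (\sum_(i < n) K * `|v|)).
  apply: ler_sum => i _; rewrite normrZ mulrC.
  by apply: ler_pM => //; [exact/ltW/Dz|exact: rV_entry_le].
rewrite sumr_const card_ord -[K * _ *+ n]mulr_natl mulrA ler_wpM2r //.
rewrite /K invfM mulrCA ger_pMr ?invr_gt0 // ler_pdivrMr // mul1r ler_nat.
exact: leqnSn.
Qed.

(** The mean value theorem on the segment from y to x, in each component: for the
    max norm the Lipschitz constant does not deteriorate. *)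
Lemma lipschitz_ball n (U : set 'rV[R]_n) (phi : 'rV[R]_n -> 'rV[R]_n) P (r : R) :
  smooth_on U phi ->
  (forall z, `|P - z| <= r -> U z /\ forall v, `|'D_v phi z| <= 2^-1 * `|v|) ->
  forall x y, `|P - x| <= r -> `|P - y| <= r ->
    `|phi x - phi y| <= 2^-1 * `|x - y|.
Proof.
move=> sphi H x y xr yr; apply: rV_norm_le; first by rewrite mulr_ge0 // invr_ge0.
move=> j; pose p (s : R) := y + s *: (x - y).
have pr (s : R) : 0 <= s <= 1 -> `|P - p s| <= r.
  move=> /andP[s0 s1].
  rewrite (_ : P - p s = (1 - s) *: (P - y) + s *: (P - x)); last first.
    rewrite /p; apply/rowP => i; rewrite !mxE; ring.
  apply: le_trans (ler_normD _ _) _; rewrite !normrZ ger0_norm ?subr_ge0 // ger0_norm //.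
  rewrite [leRHS](_ : r = (1 - s) * r + s * r); last by ring.
  by rewrite lerD // ler_wpM2l // subr_ge0.
have ce : continuous (@mxentry R 1 n 0 j) by move=> A; apply: coord_continuous.
have isd (s : R) : 0 <= s <= 1 ->
    is_derive s 1 (fun s => phi (p s) 0 j) ('D_(x - y) phi (p s) 0 j).
  move=> /pr/H[Ups _]; have dphi := smooth_differentiable sphi Ups.
  rewrite -[X in is_derive _ _ _ X](derive_lincomp (x - y) ce dphi).
  apply: (@is_derive_line _ _ _ (mxentry 0 j \o phi) y (x - y) s).
  by apply: differentiable_comp => //; apply: linear_differentiable.
have [|||s] := @MVT_segment R (fun s => phi (p s) 0 j)
    (fun s => 'D_(x - y) phi (p s) 0 j) 0 1; first exact: ler01.
- by move=> s /[!in_itv]/= /andP[s0 s1]; apply: isd; rewrite !ltW.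
- apply: derivable_within_continuous => s /[!in_itv]/= sh.
  by have [] := isd _ sh.
rewrite in_itv subr0 mulr1 /= => s01 E.
have [_ Hs] := H _ (pr _ s01).
rewrite !mxE; move: E; rewrite /p scale1r scale0r addr0 subrKC => ->.
exact: le_trans (rV_entry_le _ _) (Hs _).
Qed.

(** With k the increment of w and d = h (w + k) - h w, differentiability of f gives
    k = d B + o(d); the Lipschitz bound turns o(d) into o(k), and B is inverted. *)
Lemma differentiable_inverse n (f h : 'rV[R]_n -> 'rV[R]_n) (w : 'rV[R]_n) (C : R) :
  0 < C -> differentiable f (h w) -> jacobian f (h w) \in unitmx ->
  (\forall w' \near w, f (h w') = w' /\ `|h w' - h w| <= C * `|w' - w|) ->
  differentiable h w /\
  forall v, 'd h w v = v *m invmx (jacobian f (h w)).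
Proof.
move=> C0 df uB nh; set B := jacobian f (h w) in uB *.
pose L := mulmxr (invmx B) : {linear 'rV[R]_n -> 'rV[R]_n}.
have cL : continuous L by apply: rV_linear_continuous.
have [K K0 HK] := linear_lipschitz cL.
have eg : h \o shift w = cst (h w) + L +o_ 0 id.
  apply/eqaddoP => e e0.
  (* C bounds d by k, and K bounds the norm of the inverse of B. *)
  have e'0 : 0 < e / (K * C) by rewrite divr_gt0 // mulr_gt0.
  have /eqaddoP/(_ _ e'0) H1 := diff_locally df.
  move/nbhs_ballP: H1 => [d /= d0 Hd].
  have nh0 : \forall k \near (0 : 'rV[R]_n), f (h (k + w)) = k + w /\
      `|h (k + w) - h w| <= C * `|k|.
    move: nh; rewrite (near_shift 0) /= subr0.
    by apply: filterS => k /=; rewrite addrK.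
  have nd : \forall k \near (0 : 'rV[R]_n), C * `|k| < d.
    apply/nbhs_ballP; exists (d / C) => /=; first by rewrite divr_gt0.
    by move=> k; rewrite -ball_normE /= sub0r normrN ltr_pdivlMr // mulrC.
  apply: filterS2 nh0 nd => k [fh hk] kd.
  set x' := h (k + w) in fh hk.
  have := Hd (x' - h w); rewrite /= -ball_normE /= sub0r normrN => /(_ _).
  move=> /(_ (le_lt_trans hk kd)).
  rewrite !fctE /= subrK fh.
  have -> : f (h w) = w by case: (nbhs_singleton nh).
  rewrite opprD addrA addrK => H.
  have -> : h (k + w) - (h w + L k) = - L (k - 'd f (h w) (x' - h w)).
    rewrite /L /= -(deriveE _ df) deriveEjacobian // mulmxBl -mulmxA mulmxV //.
    by rewrite mulmx1 opprB opprD addrA.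
  rewrite normrN; apply: le_trans (HK _) _.
  rewrite -ler_pdivlMl //; apply: le_trans H _.
  apply: le_trans (ler_wpM2l (ltW e'0) hk) _.
  have Kn : K != 0 by rewrite gt_eqF.
  have Cn : C != 0 by rewrite gt_eqF.
  rewrite (_ : _ * (C * _) = K^-1 * (e * `|k|)) //.
  by move: Kn Cn; move: (`|k|) => a; move: (K) (C) (e) => b c d' bn cn; field; rewrite bn cn.
have E : 'd h w = L :> ('rV[R]_n -> 'rV[R]_n) by apply: diff_unique.
split=> [|v]; last by rewrite E.
by apply/diff_locallyP; rewrite E.
Qed.

Lemma unitmx_of_injective n (A : 'M[R]_n) :
  (forall v : 'rV_n, v *m A = 0 -> v = 0) -> A \in unitmx.
Proof.
move=> H; rewrite -row_free_unit -kermx_eq0; apply/rowV0P => v.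
by move=> /sub_kermxP; apply: H.
Qed.

Lemma open_preimage_at V W (f : V -> W) (A : set W) x : {for x, continuous f} ->
  open A -> A (f x) -> \forall y \near x, A (f y).
Proof. by move=> cf oA Ax; apply: cf; apply: open_near. Qed.

Lemma open_fst_preimage (V W : normedModType R) (A : set V) :
  open A -> open [set p : V * W | A p.1].
Proof. by apply: open_comp => p _; apply: cvg_fst. Qed.

Lemma diffeo_restrict (V W : normedModType R) (U U' : set V) (f : V -> W) :
  diffeo_onto_image U f -> open U' -> U' `<=` U -> diffeo_onto_image U' f.
Proof.
move=> [oU ofU sf [h [smh hK]]] oU' UU'; split=> //.
- rewrite openE => _ [x U'x <-]; rewrite /interior.
  have fUx : (f @` U) (f x) by exists x => //; apply: UU'.
  have ch := smooth_continuous smh fUx.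
  have n1 : \forall w \near f x, U' (h w).
    by apply: open_preimage_at => //; rewrite hK //; apply: UU'.
  apply: filterS2 n1 (open_near ofU fUx) => w U'hw [x' Ux' fx'].
  by exists (h w) => //; rewrite -fx' hK.
- exact: smooth_onS sf.
exists h; split; last by move=> x /UU'; apply: hK.
by apply: smooth_onS smh => _ [x U'x <-]; exists x => //; apply: UU'.
Qed.

(** Multiplying f by the inverse of its Jacobian at P, one may assume that
    phi = id - f has derivative 0 at P, hence is 1/2-Lipschitz near P.  Then f
    expands distances up to a constant, and f x = w is the fixed point equation
    x = w + phi x.  The derivative of the inverse h is the inverse of the Jacobian
    at h, so that its order of smoothness increases by one at each induction
    step. *)
Lemma inverse_function_rV n (U : set 'rV[R]_n) (f : 'rV[R]_n -> 'rV[R]_n) P :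
  open U -> U P -> smooth_on U f -> (forall v, 'D_v f P = 0 -> v = 0) ->
  exists U', [/\ U' P, U' `<=` U & diffeo_onto_image U' f].
Proof.
move=> oU UP sf inj.
have df x : U x -> differentiable f x by apply: smooth_differentiable.
have uA : jacobian f P \in unitmx.
  apply: unitmx_of_injective => v; rewrite -deriveEjacobian; last exact: df.
  exact: inj.
set A := jacobian f P in uA; pose Ai := invmx A.
pose l := mulmxr Ai : {linear 'rV[R]_n -> 'rV[R]_n}.
have cl : continuous l by apply: rV_linear_continuous.
pose phi x := x - l (f x).
have slf : smooth_on U (l \o f) by apply: smooth_lincomp.
have sphi : smooth_on U phi.
  by apply: smoothD => //; [exact: smooth_id|exact: smoothN].
have Dphi x v : U x -> 'D_v phi x = v - 'D_v f x *m Ai.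
  move=> Ux; have dlf := smooth_differentiable slf Ux.
  rewrite -[phi]/(id - (l \o f)) deriveB //; last exact: diff_derivable.
  by rewrite derive_id (derive_lincomp _ cl (df _ Ux)).
have D0 v : 'D_v phi P = 0.
  rewrite Dphi // deriveEjacobian; last exact: df.
  by rewrite -mulmxA mulmxV // mulmx1 subrr.
have [r r0 H] := small_derivative oU sphi UP D0.
have lip := lipschitz_ball sphi H.
have [K K0 HK] := linear_lipschitz cl.
have dist x y : `|P - x| <= r -> `|P - y| <= r ->
    `|x - y| <= 2 * `|l (f x) - l (f y)|.
  move=> xr yr; have := lip _ _ xr yr.
  have : `|x - y| <= `|phi x - phi y| + `|l (f x) - l (f y)|.
    apply: le_trans (ler_normD _ _).
    rewrite (_ : phi x - phi y + _ = x - y) // /phi.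
    by apply/rowP => i; rewrite !mxE; ring.
  move: (`|x - y|) (`|phi x - _|) (`|l _ - _|) => p q s; lra.
have distf x y : `|P - x| <= r -> `|P - y| <= r ->
    `|x - y| <= 2 * K * `|f x - f y|.
  move=> xr yr; apply: le_trans (dist _ _ xr yr) _.
  by rewrite -mulrA ler_wpM2l // -linearB HK.
have uJ x : `|P - x| <= r -> jacobian f x \in unitmx.
  move=> xr; have [Ux Hx] := H _ xr.
  apply: unitmx_of_injective => v; rewrite -deriveEjacobian; last exact: df.
  move=> Dv; have := Hx v; rewrite Dphi // Dv mul0mx subr0.
  move=> nv; apply/normr0_eq0/le_anti; rewrite normr_ge0 andbT.
  move: nv; move: (`|v|) => p; lra.
pose U' : set 'rV[R]_n := [set x | `|P - x| < r /\ `|l (f x) - l (f P)| < r / 2].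
pose W' : set 'rV[R]_n := [set w | `|l w - l (f P)| < r / 2].
have U'B x : U' x -> `|P - x| <= r by case=> /ltW.
have U'U x : U' x -> U x by move=> /U'B/H[].
have cont_dist V (g : V -> 'rV[R]_n) a (e : R) x : {for x, continuous g} ->
    `|g x - a| < e -> \forall y \near x, `|g y - a| < e.
  move=> cg ge; have : \forall y \near x, ball a e (g y).
    apply: open_preimage_at => //; first exact: ball_open.
    by rewrite -ball_normE /= distrC.
  by apply: filterS => y; rewrite -ball_normE /= distrC.
have oW' : open W'.
  rewrite openE => w /= W'w; rewrite /interior.
  by apply: cont_dist W'w; apply: cl.
have oU' : open U'.
  rewrite openE => x [xr xl]; rewrite /interior.
  have n1 : \forall y \near x, `|P - y| < r.
    have := @cont_dist _ id P r x; rewrite distrC => /(_ _ xr) n1.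
    have {}n1 := n1 (fun A => id).
    by apply: filterS n1 => y; rewrite distrC.
  have n2 : \forall y \near x, `|l (f y) - l (f P)| < r / 2.
    have cx := smooth_continuous slf (U'U x (conj xr xl)).
    exact: (cont_dist _ _ _ _ _ cx xl).
  exact: (@filterI _ (nbhs x) (nbhs_filter x) _ _ n1 n2).
have U'P : U' P by split; rewrite subrr normr0 // divr_gt0.
have surj w : W' w -> exists x, U' x /\ f x = w.
  move=> W'w; pose B : set 'rV[R]_n := closed_ball_ Num.norm P r.
  pose g x := l w + phi x.
  have BP : B P by rewrite /B /closed_ball_ /= subrr normr0 ltW.
  have gB x : B x -> `|P - g x| < r.
    move=> Bx; rewrite /g /phi distrC.
    have -> : l w + (x - l (f x)) - P = (l w - l (f P)) + (phi x - phi P).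
      by rewrite /phi; apply/rowP => i; rewrite !mxE; ring.
    apply: le_lt_trans (ler_normD _ _) _.
    have Hl : `|phi x - phi P| <= 2^-1 * r.
      apply: le_trans (lip _ _ _ _) _ => //.
      by rewrite ler_wpM2l // distrC.
    move: W'w Hl; rewrite /W' /=.
    move: (`|_|) (`|phi x - _|) => p q; lra.
  have gBB : {homo g : x / B x >-> B x} by move=> x /gB/ltW.
  have ctr : is_contraction (mkfun_fun gBB).
    have h0 : (0 : R) <= 2^-1 by [].
    exists (NngNum h0); split=> /=; first by lra.
    move=> [x y] [/= Bx By]; rewrite /g opprD addrACA subrr add0r.
    exact: lip.
  have [|//|x Bx xE] := banach_fixed_point ctr; first exact: closed_closed_ball_.
    by exists P.
  have fx : f x = w.
    have : l (f x) = l w.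
      have xE' : x = l w + (x - l (f x)) := xE.
      apply/esym/eqP; rewrite -subr_eq0.
      by rewrite -(addKr x (- l (f x))) addrCA -xE' addNr.
    rewrite /l /= => /(congr1 (mulmx^~ A)); rewrite -!mulmxA mulVmx //.
    by rewrite !mulmx1.
  exists x; split=> //; split; last by rewrite fx.
  by rewrite {1}xE; apply: gB.
have imE : f @` U' = W'.
  apply/seteqP; split=> [_ [x [_ xl] <-] //|w /surj[x [U'x fx]]].
  by exists x.
pose h w := xget P [set x | U' x /\ f x = w].
have hP w : W' w -> U' (h w) /\ f (h w) = w.
  by move=> /surj exw; have := xgetPex P exw.
have hK x : U' x -> h (f x) = x.
  move=> U'x; have [|U'h fh] := hP (f x); first by rewrite -imE; exists x.
  apply/eqP; rewrite -subr_eq0 -normr_le0.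
  apply: le_trans (distf _ _ (U'B _ U'h) (U'B _ U'x)) _.
  by rewrite fh subrr normr0 mulr0.
have dh w : W' w -> differentiable h w /\
    forall v, 'd h w v = v *m invmx (jacobian f (h w)).
  move=> W'w; have [U'h fh] := hP _ W'w.
  apply: (@differentiable_inverse _ f h w (2 * K)).
  - by rewrite mulr_gt0.
  - exact/df/U'U.
  - exact/uJ/U'B.
  apply: filterS (open_near oW' W'w) => w' /hP[U'h' fh']; split=> //.
  by have := distf _ _ (U'B _ U'h') (U'B _ U'h); rewrite fh fh'.
have sJ : smooth_on U' (jacobian f).
  apply: smooth_matrix => // i j.
  apply: smooth_on_ext (smooth_entry 0 j oU' (smooth_onS U'U
    (smooth_onD (delta_mx 0 i) sf))) => // x U'x.
  by rewrite jacobian_entry //; apply/df/U'U.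
have sh : smooth_on W' h.
  apply/smooth_onP; elim=> [|k IH]; first by split=> // w /dh[].
  split=> [w /dh[] //|v].
  have nJ : ndiff k W' (jacobian f \o h).
    apply: (ndiff_comp (coords_rV n) (U' := U') oW' _ IH); first by move=> w /hP[U'w _].
    by have /smooth_onP := sJ; apply.
  have nI : ndiff k W' (fun w => invmx (jacobian f (h w))).
    by apply: (ndiff_invmx oW' _ nJ) => w /hP[/U'B/uJ uw _].
  have nv : ndiff k W' (mulmx v \o (fun w => invmx (jacobian f (h w)))).
    apply: ndiff_matrix => // i j.
    apply: (@ndiff_ext _ _ _ _ _
      (fun w => \sum_a v i a *: invmx (jacobian f (h w)) a j)) => //.
      by move=> w _; rewrite mxE.
    apply: ndiff_sum => // a; apply: ndiff_scale => //; first exact: ndiff_cst.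
    exact: ndiff_entry.
  apply: ndiff_ext nv => // w W'w; have [dhw E] := dh _ W'w.
  by rewrite (deriveE _ dhw) E.
exists U'; split=> //; split=> //; first by rewrite imE.
  exact: smooth_onS sf.
by exists h; rewrite imE.
Qed.

Lemma inverse_function n V W (c : coords n V) (d : coords n W) (U : set V)
    (f : V -> W) P : open U -> U P -> smooth_on U f ->
  (forall v, 'D_v f P = 0 -> v = 0) ->
  exists U', [/\ U' P, U' `<=` U & diffeo_onto_image U' f].
Proof.
move=> oU UP sf inj.
pose F := toR d \o (f \o ofR c).
have oV : open (ofR c @^-1` U).
  by apply: open_comp oU => x _; apply: ofR_cont.
have sofR A : smooth_on A (ofR c) by apply: smooth_linear; apply: ofR_cont.
have stoR A : smooth_on A (toR c) by apply: smooth_linear; apply: toR_cont.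
have sfo : smooth_on (ofR c @^-1` U) (f \o ofR c).
  exact: (smooth_comp c oV (fun x => id)).
have sF : smooth_on (ofR c @^-1` U) F.
  by apply: smooth_lincomp => //; apply: toR_cont.
have VP : (ofR c @^-1` U) (toR c P) by rewrite /preimage /= toRK.
have injF v : 'D_v F (toR c P) = 0 -> v = 0.
  have dfo := smooth_differentiable sfo VP.
  have dfP : differentiable f P := smooth_differentiable sf UP.
  have dO : differentiable (ofR c) (toR c P) by apply: (smooth_differentiable (sofR setT)).
  rewrite (derive_lincomp _ (@toR_cont _ _ _ d) dfo).
  rewrite (deriveE _ dfo) diff_comp //=; last by rewrite toRK.
  rewrite toRK (diff_lin _ (@ofR_cont _ _ _ c)) -(deriveE _ dfP).
  move=> /(congr1 (ofR d)); rewrite toRK linear0 => /inj/(congr1 (toR c)).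
  by rewrite ofRK linear0.
have [V' [V'P V'V [oV' oFV' sFV' [h [sh hK]]]]] := inverse_function_rV oV VP sF injF.
exists (toR c @^-1` V').
have U'U : toR c @^-1` V' `<=` U by move=> x /V'V; rewrite /preimage /= toRK.
split=> //.
have imE : f @` (toR c @^-1` V') = toR d @^-1` (F @` V').
  apply/seteqP; split=> [_ [x V'x <-]|w [v V'v Fv]].
    by exists (toR c x) => //; rewrite /F /= toRK.
  exists (ofR c v); first by rewrite /preimage /= ofRK.
  by apply: (can_inj (toRK d)).
have oW : open (f @` (toR c @^-1` V')).
  by rewrite imE; apply: open_comp oFV' => x _; apply: toR_cont.
split=> //.
- by apply: open_comp oV' => x _; apply: toR_cont.
- exact: smooth_onS sf.
exists (ofR c \o (h \o toR d)); split.
  rewrite imE in oW *; apply: smooth_lincomp => //; first exact: ofR_cont.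
  apply: (smooth_comp (coords_rV n) oW (fun x => id) _ sh).
  by apply: smooth_linear; apply: toR_cont.
move=> x V'x /=; have := hK _ V'x; rewrite /F /= toRK => ->.
by rewrite toRK.
Qed.

End InverseFunction.

(** * Differentiation rules and plane linear algebra *)

Section Rules.
Context {R : realType}.
Implicit Types V W Z : normedModType R.

Lemma derive_comp V W Z (f : V -> W) (h : W -> Z) x v :
  differentiable f x -> differentiable h (f x) ->
  'D_v (h \o f) x = 'D_('D_v f x) h (f x).
Proof.
move=> df dh; rewrite (deriveE _ (differentiable_comp df dh)).
by rewrite (diff_comp df dh) /= (deriveE _ dh) (deriveE _ df).
Qed.

Lemma derive_linear V W (f : V -> W) x (a : R) (u v : V) :
  differentiable f x -> 'D_(a *: u + v) f x = a *: 'D_u f x + 'D_v f x.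
Proof. by move=> df; rewrite !(deriveE _ df) linearP. Qed.

Lemma derive_scalev V W (f : V -> W) x (a : R) (u : V) :
  differentiable f x -> 'D_(a *: u) f x = a *: 'D_u f x.
Proof. by move=> df; rewrite !(deriveE _ df) linearZ. Qed.

Lemma derive_addv V W (f : V -> W) x (u v : V) :
  differentiable f x -> 'D_(u + v) f x = 'D_u f x + 'D_v f x.
Proof. by move=> df; rewrite !(deriveE _ df) linearD. Qed.

Lemma derive_pair V W Z (f : V -> W) (g : V -> Z) x v :
  differentiable f x -> differentiable g x ->
  'D_v (fun x => (f x, g x)) x = ('D_v f x, 'D_v g x).
Proof.
move=> df dg; rewrite (deriveE _ (differentiable_pair df dg)).
by rewrite (diff_pair df dg) (deriveE _ df) (deriveE _ dg).
Qed.

Lemma derive_entry V m n (f : V -> 'M[R]_(m, n)) x v i j :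
  differentiable f x -> 'D_v f x i j = 'D_v (fun y => f y i j) x.
Proof.
move=> df; have ce : continuous (@mxentry R m n i j) by move=> A; apply: coord_continuous.
exact: (esym (derive_lincomp v ce df)).
Qed.

Lemma differentiable_entry V m n (f : V -> 'M[R]_(m, n)) x i j :
  differentiable f x -> differentiable (fun y => f y i j) x.
Proof.
move=> df; apply: (@differentiable_comp _ _ _ _ f (mxentry i j)) => //.
by apply: linear_differentiable => A; apply: coord_continuous.
Qed.

Lemma differentiable_mx V m n (f : V -> 'M[R]_(m, n)) x :
  (forall i j, differentiable (fun y => f y i j) x) -> differentiable f x.
Proof.
move=> df; rewrite (_ : f = \sum_i \sum_j (fun y => f y i j *: delta_mx i j)).
  by do 2 (apply: differentiable_sum => ?); apply: differentiableZl.
apply/funext => y; rewrite fct_sumE [LHS]matrix_sum_delta.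
by apply: eq_bigr => i _; rewrite fct_sumE.
Qed.

Lemma differentiable_mulmx V m n p (A : V -> 'M[R]_(m, n)) (B : V -> 'M[R]_(n, p)) x :
  differentiable A x -> differentiable B x ->
  differentiable (fun y => A y *m B y) x.
Proof.
move=> dA dB; apply: differentiable_mx => i k.
rewrite (_ : (fun y => _) = \sum_j ((fun y => A y i j) * (fun y => B y j k))).
  apply: differentiable_sum => j.
  by apply: differentiableM; apply: differentiable_entry.
by apply/funext => y; rewrite fct_sumE mxE.
Qed.

Lemma derive_mulmx V m n p (A : V -> 'M[R]_(m, n)) (B : V -> 'M[R]_(n, p)) x v :
  differentiable A x -> differentiable B x ->
  'D_v (fun y => A y *m B y) x = 'D_v A x *m B x + A x *m 'D_v B x.
Proof.
move=> dA dB; apply/matrixP => i k.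
rewrite (derive_entry _ _ _ (differentiable_mulmx dA dB)).
rewrite (_ : (fun y => _) = \sum_j ((fun y => A y i j) * (fun y => B y j k))); last first.
  by apply/funext => y; rewrite fct_sumE mxE.
have dAe j := diff_derivable (v := v) (differentiable_entry i j dA).
have dBe j := diff_derivable (v := v) (differentiable_entry j k dB).
rewrite derive_sum => [|j]; last exact: derivableM.
rewrite !mxE -big_split /=; apply: eq_bigr => j _.
rewrite (deriveM (dAe j) (dBe j)) (derive_entry _ _ _ dA) (derive_entry _ _ _ dB).
by rewrite addrC /GRing.scale /= [B x j k * _]mulrC.
Qed.

Lemma derive_trmx V m n (f : V -> 'M[R]_(m, n)) x v : differentiable f x ->
  'D_v (fun y => (f y)^T) x = ('D_v f x)^T.
Proof.
move=> df; have dT : differentiable (fun y => (f y)^T) x.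
  apply: differentiable_mx => i j; rewrite (_ : (fun y => _) = fun y => f y j i).
    exact: differentiable_entry.
  by apply/funext => y; rewrite mxE.
apply/matrixP => i j; rewrite (derive_entry _ _ _ dT) mxE (derive_entry _ _ _ df).
by congr ('D_v _ x); apply/funext => y; rewrite mxE.
Qed.

Lemma differentiable_trmx V m n (f : V -> 'M[R]_(m, n)) x : differentiable f x ->
  differentiable (fun y => (f y)^T) x.
Proof.
move=> df; apply: differentiable_mx => i j.
rewrite (_ : (fun y => _) = fun y => f y j i); first exact: differentiable_entry.
by apply/funext => y; rewrite mxE.
Qed.

Lemma derive_translate (V W : normedModType R) (f : V -> W) (a x v : V) :
  'D_v (fun z => f (z + a)) x = 'D_v f (x + a).
Proof.
rewrite /derive; congr (lim _).
suff -> : (fun h : R => h^-1 *: (((fun z => f (z + a)) \o shift x) (h *: v) - f (x + a))) =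
  (fun h : R => h^-1 *: ((f \o shift (x + a)) (h *: v) - f (x + a))) by [].
by apply/funext => h /=; rewrite addrA.
Qed.

Lemma dfst (V W : normedModType R) (p : V * W) : differentiable fst p.
Proof. by apply: linear_differentiable; apply: fst_continuous. Qed.

Lemma dsnd (V W : normedModType R) (p : V * W) : differentiable snd p.
Proof. by apply: linear_differentiable; apply: snd_continuous. Qed.

Lemma derive_fst (V W : normedModType R) (p w : V * W) : 'D_w fst p = w.1.
Proof. by rewrite (deriveE _ (dfst p)) diff_lin //; apply: fst_continuous. Qed.

Lemma derive_snd (V W : normedModType R) (p w : V * W) : 'D_w snd p = w.2.
Proof. by rewrite (deriveE _ (dsnd p)) diff_lin //; apply: snd_continuous. Qed.

Lemma derive_scale_cst (V W : normedModType R) (k : V -> R) (x w : V) (a : W) :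
  differentiable k x -> differentiable (fun z => k z *: a) x /\
  'D_w (fun z => k z *: a) x = 'D_w k x *: a.
Proof.
move=> dk; have dka := differentiableZl a dk; split=> //.
by rewrite (deriveE _ dka) (diffZl a dk) (deriveE _ dk).
Qed.

Definition pairing n (xi u : 'rV[R]_n) : R := (xi *m u^T) 0 0.

Lemma derive_pairing V n (xi u : V -> 'rV[R]_n) x v :
  differentiable xi x -> differentiable u x ->
  'D_v (fun y => pairing (xi y) (u y)) x =
    pairing ('D_v xi x) (u x) + pairing (xi x) ('D_v u x).
Proof.
move=> dxi du; have duT := differentiable_trmx du.
rewrite -(derive_entry _ _ _ (differentiable_mulmx dxi duT)).
by rewrite (derive_mulmx _ dxi duT) mxE (derive_trmx _ du).
Qed.

End Rules.

Section Wronskian.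
Context {R : realType}.

Lemma det_neq0 (a b a' b' : R) :
  (forall al be, al * a + be * b = 0 -> al * a' + be * b' = 0 ->
    al = 0 /\ be = 0) -> a * b' - b * a' != 0.
Proof.
move=> H; apply/eqP => W0.
have [b0 /eqP] : b = 0 /\ - a = 0 by apply: H; [ring|rewrite -[RHS]oppr0 -W0; ring].
rewrite oppr_eq0 => /eqP a0.
have [b'0 /eqP] : b' = 0 /\ - a' = 0 by apply: H; [rewrite a0 b0; ring|ring].
rewrite oppr_eq0 => /eqP a'0.
have [/eqP] : (1 : R) = 0 /\ (0 : R) = 0.
  by apply: H; rewrite ?a0 ?b0 ?a'0 ?b'0; ring.
by rewrite oner_eq0.
Qed.

Lemma zero_det (a b a' b' : R) : a = 0 -> b = 0 -> a * b' - b * a' = 0.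
Proof. by move=> -> ->; rewrite !mul0r subrr. Qed.

Lemma cross0 (x y : R) : x * y + - y * x = 0.
Proof. by ring. Qed.

Lemma wronskian_kernel (a b a' b' m k mu : R) :
  a * b' - b * a' != 0 -> mu != 0 -> m * a + mu * (k * a') = 0 ->
  m * b + mu * (k * b') = 0 -> m = 0 /\ k = 0.
Proof.
move=> W mu0 Ea Eb; split; apply/eqP.
  have : m * (a * b' - b * a') = 0.
    transitivity (b' * (m * a + mu * (k * a')) - a' * (m * b + mu * (k * b'))).
      by ring.
    by rewrite Ea Eb; ring.
  by move/eqP; rewrite mulf_eq0 (negbTE W) orbF.
have : mu * k * (a * b' - b * a') = 0.
  transitivity (a * (m * b + mu * (k * b')) - b * (m * a + mu * (k * a'))).
    by ring.
  by rewrite Ea Eb; ring.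
by move/eqP; rewrite !mulf_eq0 (negbTE W) (negbTE mu0) orbF.
Qed.

Lemma cross_of_proportional (a1 b1 a2 b2 m1 m2 : R) : m1 != 0 ->
  m1 * a1 = m2 * a2 -> m1 * b1 = m2 * b2 -> a1 * b2 - a2 * b1 = 0.
Proof.
move=> m0 Ea Eb; apply: (mulfI m0); rewrite mulr0.
transitivity (m1 * a1 * b2 - a2 * (m1 * b1)); first by ring.
by rewrite Ea Eb; ring.
Qed.

Lemma cross_scaled (mu a1 b1 a2 b2 : R) :
  a1 * b2 = a2 * b1 -> mu * a2 * b1 = mu * a1 * b2.
Proof. by move=> e; rewrite -!mulrA e. Qed.

Lemma cross_factor (a1 b1 a2 b2 k s X P : R) :
  k * P = b1 * a2 - a1 * b2 -> P = s * X ->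
  a1 * b2 - a2 * b1 = - (k * s) * X.
Proof. by move=> e eP; rewrite mulNr -mulrA -eP e; ring. Qed.

Lemma mul_eq0_both (a b m1 m2 : R) : a = 0 -> b = 0 -> m1 * a = m2 * b.
Proof. by move=> -> ->; rewrite !mulr0. Qed.

Lemma mul_eq0_right (k a : R) : k != 0 -> k * a = 0 -> a = 0.
Proof. by move=> k0 /eqP; rewrite mulf_eq0 (negbTE k0) => /eqP. Qed.

(** The common factor is m1 / a2, or m1 / b2 when a1 and a2 vanish. *)
Lemma proportional_cases (a1 b1 a2 b2 m1 m2 : R) : m1 != 0 -> m2 != 0 ->
  m1 * a1 = m2 * a2 -> m1 * b1 = m2 * b2 -> (a1 = 0 -> b1 <> 0) ->
  (exists mu, [/\ mu != 0, m1 = mu * a2 & m2 = mu * a1]) \/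
  [/\ a1 = 0, a2 = 0 &
    exists mu, [/\ mu != 0, m1 = mu * b2 & m2 = mu * b1]].
Proof.
have common x1 x2 : m1 != 0 -> m2 != 0 -> m1 * x1 = m2 * x2 -> x1 != 0 ->
    exists mu, [/\ mu != 0, m1 = mu * x2 & m2 = mu * x1].
  move=> n1 n2 e x10; have x20 : x2 != 0.
    apply/eqP => x20; move: e; rewrite x20 mulr0 => /eqP.
    by rewrite mulf_eq0 (negbTE n1) (negbTE x10).
  exists (m1 / x2); rewrite mulf_neq0 ?invr_neq0 //; split=> //.
    by rewrite divfK.
  by rewrite mulrAC e mulfK.
move=> n1 n2 Ea Eb ab; have [a10|a10] := eqVneq a1 0; last by left; apply: common.
right; split=> //; last by apply: common => //; apply/eqP/ab.
by apply: (mul_eq0_right n2); rewrite -Ea a10 mulr0.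
Qed.

Lemma scale_unique (a b m1 m2 : R) : (a = 0 -> b <> 0) ->
  m1 * a = m2 * a -> m1 * b = m2 * b -> m1 = m2.
Proof.
move=> ab Ea Eb; have [a0|an] := eqVneq a 0; last exact: (mulIf an Ea).
by have /eqP bn := ab a0; exact: (mulIf bn Eb).
Qed.

End Wronskian.

Section Plane.
Context {R : realType}.
Local Notation E := 'rV[R]_2.

Lemma sum2 (F : 'I_2 -> R) : \sum_i F i = F 0 + F 1.
Proof.
rewrite 2!big_ord_recl big_ord0 addr0; congr (F _ + F _); exact: val_inj.
Qed.

Lemma pairing2 (xi u : E) : pairing xi u = xi 0 0 * u 0 0 + xi 0 1 * u 0 1.
Proof. by rewrite /pairing mxE sum2 !mxE. Qed.

Lemma det2 (A : 'M[R]_2) : \det A = A 0 0 * A 1 1 - A 0 1 * A 1 0.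
Proof.
rewrite (expand_det_row _ 0) sum2 /cofactor !det_mx11 !mxE /= expr0 mul1r.
rewrite expr1 mulN1r mulrN.
by congr (_ * A _ _ - _ * A _ _); apply: val_inj.
Qed.

Lemma row2P (u v : E) : u 0 0 = v 0 0 -> u 0 1 = v 0 1 -> u = v.
Proof.
move=> e0 e1; apply/rowP => i; have [->|->] // : i = 0 \/ i = 1.
by case: i => [[|[|//]] Hi]; [left|right]; apply: val_inj.
Qed.

Lemma row2_eq0 (u : E) : u != 0 -> u 0 0 != 0 \/ u 0 1 != 0.
Proof.
have [e0|?] := eqVneq (u 0 0) 0; last by left.
have [e1|?] := eqVneq (u 0 1) 0; last by right.
by move=> /eqP[]; apply: row2P; rewrite mxE.
Qed.

Lemma pairingDr (xi u v : E) : pairing xi (u + v) = pairing xi u + pairing xi v.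
Proof. by rewrite !pairing2 !mxE; ring. Qed.

Lemma pairingZr (xi u : E) k : pairing xi (k *: u) = k * pairing xi u.
Proof. by rewrite !pairing2 !mxE; ring. Qed.

Lemma pairing_lin (xi u v : E) a b :
  pairing xi (a *: u + b *: v) = a * pairing xi u + b * pairing xi v.
Proof. by rewrite pairingDr !pairingZr. Qed.

Lemma pairingZl (xi u : E) k : pairing (k *: xi) u = k * pairing xi u.
Proof. by rewrite !pairing2 !mxE; ring. Qed.

Lemma rank_lt2 (A : 'M[R]_2) : (\rank A < 2)%N <-> \det A = 0.
Proof.
have -> : (\rank A < 2)%N = ~~ row_free A.
  by rewrite ltn_neqAle rank_leq_row andbT.
rewrite row_free_unit unitmxE unitfE negbK; split=> [/eqP //|->]; exact: eqxx.
Qed.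

Lemma scale_neq0 (k : R) (v : E) : k *: v != 0 -> k != 0.
Proof. by rewrite scaler_eq0 negb_or => /andP[]. Qed.

Lemma annihilated_parallel (u w : E) : u != 0 ->
  u 0 0 * w 0 1 = u 0 1 * w 0 0 -> exists k : R, w = k *: u.
Proof.
move=> /row2_eq0[h|h] e.
  exists (w 0 0 / u 0 0); apply: row2P; rewrite mxE; first by rewrite divfK.
  by apply: (mulfI h); rewrite e; field.
exists (w 0 1 / u 0 1); apply: row2P; rewrite mxE; last by rewrite divfK.
by apply: (mulfI h); rewrite -e; field.
Qed.

Section Metric.
Context (g : E -> 'M[R]_2) (x : E).
Context (gsym : (g x)^T = g x).
Context (gpos : forall u, u != 0 -> 0 < inner g x u u).

Let gsym01 : g x 0 1 = g x 1 0.
Proof. by rewrite -{1}gsym mxE. Qed.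

Lemma flat2 u : flat g x u 0 0 = u 0 0 * g x 0 0 + u 0 1 * g x 0 1 /\
  flat g x u 0 1 = u 0 0 * g x 0 1 + u 0 1 * g x 1 1.
Proof. by rewrite /flat !mxE !sum2 gsym01. Qed.

Lemma inner_pairing u w : inner g x u w = pairing (flat g x u) w.
Proof. by []. Qed.

Lemma inner2 u w : inner g x u w =
  (u 0 0 * g x 0 0 + u 0 1 * g x 0 1) * w 0 0 +
  (u 0 0 * g x 0 1 + u 0 1 * g x 1 1) * w 0 1.
Proof. by rewrite inner_pairing pairing2; have [-> ->] := flat2 u. Qed.

Lemma inner_sym u w : inner g x u w = inner g x w u.
Proof. by rewrite !inner2; ring. Qed.

(** The vector (- g01, g00) has squared length g00 det g. *)
Lemma metric_det_gt0 : 0 < \det (g x).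
Proof.
pose e : E := \row_k (if k == 0 then 1 else 0).
have e0 : e != 0 by apply/eqP => /rowP/(_ 0)/eqP; rewrite !mxE /= oner_eq0.
have g00 : 0 < g x 0 0.
  by have := gpos e0; rewrite inner2 !mxE /= !(mul0r, mul1r, mulr0, mulr1, addr0).
(* This vector is g-orthogonal to e. *)
pose u : E := \row_k (if k == 0 then - g x 0 1 else g x 0 0).
have u0 : u != 0.
  by apply/eqP => /rowP/(_ 1)/eqP; rewrite !mxE /= gt_eqF.
have := gpos u0; rewrite inner2 !mxE /= det2 -gsym01.
rewrite (_ : _ + _ = g x 0 0 * (g x 0 0 * g x 1 1 - g x 0 1 * g x 0 1)); last by ring.
by rewrite pmulr_rgt0.
Qed.

Let s := Num.sqrt (\det (g x)).
Let s0 : 0 < s. Proof. by rewrite sqrtr_gt0 metric_det_gt0. Qed.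
Let ss : s * s = g x 0 0 * g x 1 1 - g x 0 1 * g x 0 1.
Proof. by rewrite -expr2 sqr_sqrtr ?ltW ?metric_det_gt0 // det2 -gsym01. Qed.

Lemma rot902 u : rot90 g x u 0 0 = - s^-1 * (u 0 0 * g x 0 1 + u 0 1 * g x 1 1) /\
  rot90 g x u 0 1 = s^-1 * (u 0 0 * g x 0 0 + u 0 1 * g x 0 1).
Proof.
rewrite /rot90; have [f0 f1] := flat2 u.
by split; rewrite mxE [X in _ * X]mxE /= -/s ?f0 ?f1; ring.
Qed.

(** As a covector the rotation of u is, up to a positive factor, the Euclidean
    one; in particular it depends on g only through the determinant. *)
Lemma flat_rot90 u : flat g x (rot90 g x u) =
  s *: \row_k (if k == 0 then - u 0 1 else u 0 0).
Proof.
have [r0 r1] := rot902 u; have [f0 f1] := flat2 (rot90 g x u).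
have sn : s != 0 by rewrite gt_eqF.
apply: row2P; rewrite ?f0 ?f1 r0 r1 !mxE /=; apply: (mulfI sn).
  rewrite mulrA ss; transitivity (s * s^-1 * - ((g x 0 0 * g x 1 1 - g x 0 1 * g x 0 1) * u 0 1)); first by ring.
  by rewrite divff // mul1r mulrN.
rewrite mulrA ss; transitivity (s * s^-1 * ((g x 0 0 * g x 1 1 - g x 0 1 * g x 0 1) * u 0 0)); first by ring.
by rewrite divff // mul1r.
Qed.

Lemma inner_rot90_left u w : inner g x (rot90 g x u) w =
  s * (u 0 0 * w 0 1 - u 0 1 * w 0 0).
Proof. by rewrite inner_pairing flat_rot90 pairing2 !mxE /=; ring. Qed.

Lemma inner_rot90_self u : inner g x (rot90 g x u) u = 0.
Proof. by rewrite inner_rot90_left; ring. Qed.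

Lemma inner_rot90 u : inner g x (rot90 g x u) (rot90 g x u) = inner g x u u.
Proof.
rewrite inner_rot90_left; have [-> ->] := rot902 u; rewrite inner2.
have sn : s != 0 by rewrite gt_eqF.
transitivity (s * s^-1 * (u 0 0 * (u 0 0 * g x 0 0 + u 0 1 * g x 0 1) +
  u 0 1 * (u 0 0 * g x 0 1 + u 0 1 * g x 1 1))); first by ring.
by rewrite divff // mul1r; ring.
Qed.

Lemma inner_rot90_eq0 u w : u != 0 -> inner g x (rot90 g x u) w = 0 ->
  exists k : R, w = k *: u.
Proof.
move=> u0 /eqP; rewrite inner_rot90_left mulf_eq0 gt_eqF //= subr_eq0.
by move=> /eqP; apply: annihilated_parallel.
Qed.

Lemma rot90_neq0 u : u != 0 -> rot90 g x u != 0.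
Proof.
move=> u0; apply/eqP => E0; have := gpos u0.
by rewrite -inner_rot90 E0 /inner !mul0mx mxE ltxx.
Qed.

Lemma inner_eq0 u w : u != 0 -> inner g x u w = 0 ->
  exists k : R, w = k *: rot90 g x u.
Proof.
move=> u0 E0; apply: annihilated_parallel; first exact: rot90_neq0.
have [-> ->] := rot902 u; move: E0; rewrite inner2.
move=> /eqP; rewrite addr_eq0 => /eqP E0.
by rewrite -[RHS]mulrA E0; ring.
Qed.

Lemma inner_both_eq0 u w : u != 0 -> inner g x (rot90 g x u) w = 0 ->
  inner g x u w = 0 -> w = 0.
Proof.
move=> u0 /(inner_rot90_eq0 u0)[k ->] /eqP.
rewrite (_ : inner g x u (k *: u) = k * inner g x u u); last first.
  by rewrite !inner2 !mxE; ring.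
by rewrite mulf_eq0 (gt_eqF (gpos u0)) orbF => /eqP ->; rewrite scale0r.
Qed.

Lemma inner_scaler u w (k : R) : inner g x u (k *: w) = k * inner g x u w.
Proof. by rewrite !inner2 !mxE; ring. Qed.

Lemma inner_addr u w w' : inner g x u (w + w') = inner g x u w + inner g x u w'.
Proof. by rewrite !inner2 !mxE; ring. Qed.

(** This puts the circle of [exp_polar] in the unit bundle, where the curves are
    defined. *)
Lemma inner_circle u (c d : R) : inner g x u u = 1 -> c ^+ 2 + d ^+ 2 = 1 ->
  inner g x (c *: u + d *: rot90 g x u) (c *: u + d *: rot90 g x u) = 1.
Proof.
move=> u1 cd; have ru := inner_rot90_self u; have rr := inner_rot90 u.
move: (rot90 g x u) ru rr => r ru rr.
rewrite inner_addr !inner_scaler !(inner_sym (_ + _)) !inner_addr !inner_scaler.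
by rewrite [inner g x u r]inner_sym rr ru u1 -[RHS]cd; ring.
Qed.

End Metric.
End Plane.

(** * Curves, conormals and the canonical relation *)

Section Curves.
Context {R : realType}.
Local Notation E := 'rV[R]_2.
Local Notation T3 := ((R * R) * R)%type.
Context (M : set E) (g : E -> 'M[R]_2).
Context (J : E -> E -> set R) (c : E -> E -> R -> E).
Context (I : E -> E -> set R) (gam : E -> E -> R -> E).
Context (O : set (R * R)) (chart : R * R -> E).
Context (D : set (R * R)) (dir : R -> R -> E).
Context (y0 eta0 : R) (p0 v0 : E).
Context (Hg : riemannian_metric M g).
Context (Hus : unit_speed_curves M g J c I gam).
Context (Hlp : local_parameterization M g O chart D dir y0 eta0 p0 v0).

Definition pos (z : T3) : E := curve gam chart dir z.1.1 z.1.2 z.2.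
Definition curve_dom : set T3 := [set z | D z.1 /\ times I chart dir z.1.1 z.1.2 z.2].
Definition e_t : T3 := (0, 0, 1).
Definition e_y : T3 := (1, 0, 0).
Definition e_eta : T3 := (0, 1, 0).
Definition vel (z : T3) : E := 'D_e_t pos z.
Definition phase (z : T3) : E * E := (pos z, vel z).

Let cRR : coords (1 + 1) (R * R)%type := coords_prod coords_R coords_R.
Let cT3 : coords (1 + 1 + 1) T3 := coords_prod cRR coords_R.
Let cE : coords 2 E := coords_rV 2.
Let cEER : coords (2 + 2 + 1) (E * E * R)%type :=
  coords_prod (coords_prod cE cE) coords_R.

Let all_times : set T3 := [set z | D z.1].
Let start (z : T3) : E * E * R := (chart (0, z.1.1), dir z.1.1 z.1.2, z.2).

Let open_all_times : open all_times.
Proof.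
apply: open_comp (lp_open Hlp) => z _; exact: cvg_fst.
Qed.

Lemma smooth_start : smooth_on all_times start.
Proof.
have sid : smooth_on all_times (fun z : T3 => z) by apply: smooth_id.
have s1 := smooth_fst open_all_times sid; have s11 := smooth_fst open_all_times s1.
have s0 : smooth_on all_times (fun=> 0 : R) by apply: smooth_cst.
apply: smooth_pair => //; last exact: smooth_snd open_all_times sid.
apply: smooth_pair => //.
  have [_ _ sch _] := lp_chart Hlp.
  apply: (smooth_comp cRR open_all_times _ (smooth_pair open_all_times s0 s11) sch).
  by move=> [[y eta] t] /(lp_dom Hlp).
apply: (smooth_comp cRR (U' := D) open_all_times _ s1 (lp_smooth Hlp)).
by move=> z.
Qed.

Lemma unit_start z : all_times z -> unit_bundle M g (start z).1.
Proof. by case: z => [[y eta] t] /(lp_unit Hlp). Qed.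

(** The unit bundle is not open, so the chain rule applies to the flow only
    through smooth extensions to open sets. *)
Lemma flow_extension (p : E * E * R) : unit_bundle M g p.1 -> I p.1.1 p.1.2 p.2 ->
  exists (U : set (E * E * R)) (h : E * E * R -> E),
    [/\ open U, U p, smooth_on U h &
      forall q, U q -> unit_bundle M g q.1 ->
        I q.1.1 q.1.2 q.2 /\ h q = gam q.1.1 q.1.2 q.2].
Proof.
move=> up Ip; have [_ /(_ p (conj up Ip)) [U1 [oU1 U1p HU1]]] := us_open Hus.
have [U2 [h [oU2 U2p sh hE]]] := us_smooth Hus (conj up Ip).
exists (U1 `&` U2), h; split.
- exact: openI.
- by split.
- by apply: smooth_onS sh => q [].
move=> q [U1q U2q] uq; have [_ Iq] := HU1 q (conj U1q uq).
by split=> //; rewrite hE.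
Qed.

Lemma open_curve_dom : open curve_dom.
Proof.
rewrite openE => z [Dz Iz]; rewrite /interior.
have [U [h [oU Uz _ HU]]] := flow_extension (unit_start Dz) Iz.
have cs := smooth_continuous smooth_start Dz.
have n1 : \forall z' \near z, U (start z') by apply: open_preimage_at.
have n2 : \forall z' \near z, all_times z' by apply: open_near.
apply: filterS2 n1 n2 => z' Uz' Dz'.
by split=> //; have [] := HU _ Uz' (unit_start Dz').
Qed.

Lemma smooth_pos : smooth_on curve_dom pos.
Proof.
apply: smooth_on_local => z [Dz Iz].
have [U [h [oU Uz sh HU]]] := flow_extension (unit_start Dz) Iz.
exists (all_times `&` start @^-1` U), (h \o start); split.
- rewrite openE => z' [Dz' Uz']; rewrite /interior.
  have cs := smooth_continuous smooth_start Dz'.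
  have n1 : \forall z' \near z', U (start z') by apply: open_preimage_at.
  by have n2 := open_near open_all_times Dz'; apply: filterI.
- by [].
- apply: (smooth_comp cEER (U' := U)) sh; last 2 first.
  + by move=> z' [].
  + by apply: smooth_onS smooth_start => z' [].
  rewrite openE => z' [Dz' Uz']; rewrite /interior.
  have cs := smooth_continuous smooth_start Dz'.
  have n1 : \forall z' \near z', U (start z') by apply: open_preimage_at.
  by have n2 := open_near open_all_times Dz'; apply: filterI.
- by move=> z' [Dz' Uz'] /=; have [_ ->] := HU _ Uz' (unit_start Dz').
Qed.

Lemma smooth_vel : smooth_on curve_dom vel.
Proof. exact: smooth_onD smooth_pos. Qed.

Lemma dpos z : curve_dom z -> differentiable pos z.
Proof. exact: smooth_differentiable smooth_pos. Qed.

Lemma dvel z : curve_dom z -> differentiable vel z.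
Proof. exact: smooth_differentiable smooth_vel. Qed.

Lemma slice_t (z : T3) (h s : R) : (z.1, h + s) = h *: e_t + (z.1, s) :> T3.
Proof.
by do 2?[apply: pairP]; rewrite /= ?scaler0 ?add0r // [_ *: _]mulr1.
Qed.

Lemma velocity_curve y eta t :
  velocity (curve gam chart dir y eta) t = vel (y, eta, t).
Proof.
apply: (@derive1_slice _ _ _ pos (fun t => (y, eta, t)) t e_t) => h.
exact: (slice_t (y, eta, 0) h t).
Qed.

Lemma derive_curve_y y eta t :
  derive1 (fun y' => curve gam chart dir y' eta t) y = 'D_e_y pos (y, eta, t).
Proof.
apply: (@derive1_slice _ _ _ pos (fun y => (y, eta, t)) y e_y) => h.
by do 2?[apply: pairP]; rewrite /= ?scaler0 ?add0r // [_ *: _]mulr1.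
Qed.

Lemma derive_curve_eta y eta t :
  derive1 (fun eta' => curve gam chart dir y eta' t) eta = 'D_e_eta pos (y, eta, t).
Proof.
apply: (@derive1_slice _ _ _ pos (fun eta => (y, eta, t)) eta e_eta) => h.
by do 2?[apply: pairP]; rewrite /= ?scaler0 ?add0r // [_ *: _]mulr1.
Qed.

Lemma unit_phase z : curve_dom z -> unit_bundle M g (phase z).
Proof.
case: z => [[y eta] t] [Dz Iz]; rewrite /phase -velocity_curve.
exact: (us_unit Hus (unit_start Dz) Iz).
Qed.

Definition tshift (s : R) (z : T3) : T3 := (z.1, z.2 + s).

Lemma tshiftE s z : tshift s z = z + (0, 0, s).
Proof. by do 2?[apply: pairP]; rewrite /= ?addr0. Qed.

Lemma flow_gam z s : curve_dom z ->
  (I (pos z) (vel z) s = I (chart (0, z.1.1)) (dir z.1.1 z.1.2) (z.2 + s) :> Prop) /\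
  (curve_dom (tshift s z) -> gam (pos z) (vel z) s = pos (tshift s z)).
Proof.
case: z => [[y eta] t] [Dz Iz].
have [E1 E2] := us_flow Hus (unit_start Dz) Iz.
rewrite -velocity_curve; split; first by rewrite [I _ _]E1.
by move=> [_ Is]; apply: E2.
Qed.

(** The flow property: the curve issued from the point and velocity reached at
    time t is the same curve with its time shifted. *)
Lemma flow_relation z (tau : R) : curve_dom z -> curve_dom (tshift tau z) ->
  exists (U : set (E * E * R)) (h : E * E * R -> E),
    [/\ open U, U (phase z, tau), smooth_on U h,
      (forall q, U q -> unit_bundle M g q.1 -> h q = gam q.1.1 q.1.2 q.2) &
      forall z' s, curve_dom z' -> U (phase z', s) -> h (phase z', s) = pos (tshift s z')].
Proof.
move=> Oz Os; have [E1 _] := flow_gam tau Oz.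
have Iz : I (pos z) (vel z) tau by rewrite E1; case: Os.
have [U [h [oU Uz smh HU]]] := flow_extension (p := (phase z, tau)) (unit_phase Oz) Iz.
exists U, h; split=> // [q Uq uq|z' s Oz' Uz']; first by have [] := HU _ Uq uq.
have [Is ->] := HU _ Uz' (unit_phase Oz'); have [E1' E2'] := flow_gam s Oz'.
by apply: E2'; split; [case: Oz'|rewrite /= -[times _ _ _ _ _ _]E1'].
Qed.

Section FlowDerivative.
Context (z : T3) (tau : R) (U : set (E * E * R)) (h : E * E * R -> E).
Context (Oz : curve_dom z) (Os : curve_dom (tshift tau z)) (oU : open U) (Uz : U (phase z, tau)).
Context (smh : smooth_on U h).
Context (hE : forall z' s, curve_dom z' -> U (phase z', s) -> h (phase z', s) = pos (tshift s z')).

Let diff_phase_tau : differentiable (fun z' : T3 => (phase z', tau) : E * E * R) z.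
Proof.
apply: differentiable_pair => //.
by apply: differentiable_pair; [apply: dpos|apply: dvel].
Qed.

Let derive_phase_tau w :
  'D_w (fun z' : T3 => (phase z', tau) : E * E * R) z = (('D_w pos z, 'D_w vel z), 0).
Proof.
have dP := differentiable_pair (dpos Oz) (dvel Oz).
rewrite (derive_pair _ dP (differentiable_cst tau z)) derive_cst.
by rewrite (derive_pair _ (dpos Oz) (dvel Oz)).
Qed.

Let nearU : \forall z' \near z, curve_dom z' /\ U (phase z', tau).
Proof.
have n1 := open_near open_curve_dom Oz.
have n2 : \forall z' \near z, U (phase z', tau).
  by apply: open_preimage_at => //; apply: differentiable_continuous diff_phase_tau.
exact: filterI n1 n2.
Qed.

Lemma flow_velocity z' : curve_dom z' -> U (phase z', tau) ->
  vel (tshift tau z') = 'D_((0, 0, 1) : E * E * R) h (phase z', tau).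
Proof.
move=> Oz' Uz'; pose v : E * E * R := (0, 0, 1).
have E1 : derive1 (h \o (fun s => (phase z', s))) tau = 'D_v h (phase z', tau).
  apply: derive1_slice => k.
  by do 2?[apply: pairP]; rewrite /= ?scaler0 ?add0r // [_ *: _]mulr1.
rewrite -E1 derive1E.
have -> : vel (tshift tau z') = derive1 (pos \o (fun s => tshift s z')) tau.
  apply/esym; apply: derive1_slice => k; rewrite /tshift addrCA.
  exact: slice_t.
rewrite derive1E; apply: near_eq_derive.
have cs : {for tau, continuous (fun s : R => (phase z', s) : E * E * R)}.
  by apply: differentiable_continuous; apply: differentiable_pair.
by apply: filterS (open_preimage_at cs oU Uz') => s Us /=; rewrite hE.
Qed.

(** Differentiating the flow relation: the derivative of the flow carries the
    variations of the curves at one time to those at another time.  Since h is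
    differentiated at [phase z], only the variation of [phase z] matters. *)
Lemma flow_derive w :
  'D_w pos (tshift tau z) = 'D_(('D_w pos z, 'D_w vel z, 0) : E * E * R) h (phase z, tau) /\
  'D_w vel (tshift tau z) =
    'D_(('D_w pos z, 'D_w vel z, 0) : E * E * R) ('D_((0, 0, 1) : E * E * R) h) (phase z, tau).
Proof.
have transl (f : T3 -> E) : 'D_w f (tshift tau z) = 'D_w (fun z' => f (tshift tau z')) z.
  rewrite tshiftE -(derive_translate f).
  by congr ('D_w _ z); apply/funext => z'; rewrite tshiftE.
have dh : differentiable h (phase z, tau) by apply: smooth_differentiable smh Uz.
have dDh : differentiable ('D_((0, 0, 1) : E * E * R) h) (phase z, tau).
  exact: smooth_differentiable (smooth_onD _ smh) Uz.
have C1 := derive_comp w diff_phase_tau dh; have C2 := derive_comp w diff_phase_tau dDh.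
rewrite derive_phase_tau in C1 C2; rewrite !transl -C1 -C2.
split; apply: near_eq_derive; apply: filterS nearU => z' [Oz' Uz'] /=.
  by rewrite hE.
exact: flow_velocity.
Qed.

End FlowDerivative.

Lemma param_basis (w : T3) : w = w.1.1 *: e_y + (w.1.2 *: e_eta + w.2 *: e_t).
Proof.
by do 2?[apply: pairP]; rewrite /= ?scaler0 ?add0r ?addr0 // [_ *: _]mulr1.
Qed.

Lemma derive_T3 (W : normedModType R) (f : T3 -> W) z w : differentiable f z ->
  'D_w f z = w.1.1 *: 'D_e_y f z + (w.1.2 *: 'D_e_eta f z + w.2 *: 'D_e_t f z).
Proof.
move=> df; rewrite {1}(param_basis w) !(derive_addv _ _ df).
by rewrite !(derive_scalev _ _ df).
Qed.

Lemma pos0 y eta : D (y, eta) -> pos (y, eta, 0) = chart (0, y).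
Proof. by move=> Dz; have [] := us_init Hus (lp_unit Hlp Dz). Qed.

Lemma vel0 y eta : D (y, eta) -> vel (y, eta, 0) = dir y eta.
Proof.
by move=> Dz; rewrite -velocity_curve; have [] := us_init Hus (lp_unit Hlp Dz).
Qed.

Lemma curve_dom_time0 y eta : D (y, eta) -> curve_dom (y, eta, 0).
Proof. by move=> Dz; split=> //; have [] := us_interval Hus (lp_unit Hlp Dz). Qed.

Lemma chart_y_neq0 y eta : D (y, eta) -> derive1 (fun y' => chart (0, y')) y != 0.
Proof.
move=> Dz; have Oy := lp_dom Hlp Dz; have [oO oi sch [k [sk kK]]] := lp_chart Hlp.
pose v : R * R := (0, 1).
have Ech : derive1 (fun y' => chart (0, y')) y = 'D_v chart (0, y).
  apply: (@derive1_slice _ _ _ chart (fun y' => (0, y')) y v) => h.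
  by apply: pairP; rewrite /= ?scaler0 ?add0r // [_ *: _]mulr1.
rewrite Ech; apply/eqP => E0.
have dch := smooth_differentiable sch Oy.
have dk : differentiable k (chart (0, y)).
  by apply: smooth_differentiable sk _; exists (0, y).
have := derive_comp v dch dk; rewrite E0 derive0.
have -> : 'D_v (k \o chart) (0, y) = 'D_v id (0, y).
  by apply: near_eq_derive; apply: filterS (open_near oO Oy) => z /kK.
by rewrite derive_id => /(congr1 snd)/eqP; rewrite /= oner_eq0.
Qed.

(** The position varies by w_y d(chart)/dy + w_t dir, two independent vectors by
    transversality; once w_y = w_t = 0, the velocity varies by w_eta d(dir)/deta,
    which is not zero for w_eta <> 0. *)
Lemma phase_immersion0 y eta (w : T3) : D (y, eta) ->
  'D_w pos (y, eta, 0) = 0 -> 'D_w vel (y, eta, 0) = 0 -> w = 0.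
Proof.
move=> Dz; have Oz := curve_dom_time0 Dz; have oD := lp_open Hlp.
have cy : {for y, continuous (fun y' : R => (y', eta))}.
  by apply: differentiable_continuous; apply: differentiable_pair.
have ceta : {for eta, continuous (fun eta' : R => (y, eta'))}.
  by apply: differentiable_continuous; apply: differentiable_pair.
have nDy : \forall y' \near y, D (y', eta) := open_preimage_at cy oD Dz.
have nDeta : \forall eta' \near eta, D (y, eta') := open_preimage_at ceta oD Dz.
have Gy : 'D_e_y pos (y, eta, 0) = derive1 (fun y' => chart (0, y')) y.
  rewrite -derive_curve_y !derive1E; apply: near_eq_derive.
  by apply: filterS nDy => y' /pos0.
have Geta : 'D_e_eta pos (y, eta, 0) = 0.
  rewrite -derive_curve_eta derive1E -(derive_cst (chart (0, y)) eta 1).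
  by apply: near_eq_derive; apply: filterS nDeta => y' /pos0.
have Gt : 'D_e_t pos (y, eta, 0) = dir y eta by apply: vel0.
have Veta : 'D_e_eta vel (y, eta, 0) = derive1 (dir y) eta.
  have <- : derive1 (vel \o (fun eta' => (y, eta', 0))) eta = 'D_e_eta vel (y, eta, 0).
    apply: derive1_slice => k.
    by do 2?[apply: pairP]; rewrite /= ?scaler0 ?add0r // [_ *: _]mulr1.
  rewrite !derive1E; apply: near_eq_derive.
  by apply: filterS nDeta => y' /vel0.
rewrite (derive_T3 _ (dpos Oz)) (derive_T3 _ (dvel Oz)) Gy Geta Gt Veta.
rewrite scaler0 add0r => EG EV; have tr := lp_transversal Hlp Dz.
have w2 : w.2 = 0.
  apply/eqP; apply/negPn/negP => w2n.
  (* Otherwise dir would be this multiple of d(chart)/dy. *)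
  have /eqP[] := tr (- (w.2^-1 * w.1.1)); apply: (scalerI w2n).
  by rewrite scalerA mulrN mulVKf // scaleNr; apply/eqP; rewrite -addr_eq0 addrC EG.
move: EG EV; rewrite w2 !scale0r !addr0 => /eqP.
rewrite scaler_eq0 (negbTE (chart_y_neq0 Dz)) orbF => /eqP w11.
rewrite w11 scale0r add0r => /eqP.
rewrite scaler_eq0 (negbTE (lp_regular Hlp Dz)) orbF => /eqP w12.
by do 2?[apply: pairP].
Qed.

(** A variation that is zero at time t is carried by the flow to one that is zero
    at time 0. *)
Lemma phase_immersion z (w : T3) : curve_dom z ->
  'D_w pos z = 0 -> 'D_w vel z = 0 -> w = 0.
Proof.
move=> Oz; have Dz : D z.1 by case: Oz.
have Ez : tshift (- z.2) z = (z.1.1, z.1.2, 0).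
  by case: z {Oz Dz} => [[y eta] t]; rewrite /tshift /= subrr.
have Os : curve_dom (tshift (- z.2) z).
  by rewrite Ez; apply: curve_dom_time0; case: z Dz {Oz Ez} => [[y eta] t].
have [U [h [oU Uz smh _ hE]]] := flow_relation Oz Os.
have [EG EV] := flow_derive Oz oU Uz smh hE w.
move=> G0 V0; rewrite G0 V0 !derive0 Ez in EG EV.
apply: phase_immersion0 EG EV.
by case: z Dz {Oz Ez Os Uz G0 V0} => [[y eta] t].
Qed.

Lemma metric_sym z : curve_dom z -> (g (pos z))^T = g (pos z).
Proof. by move=> /unit_phase[Mz _]; have [] := Hg.2 _ Mz. Qed.

Lemma metric_pos z : curve_dom z -> forall u, u != 0 -> 0 < inner g (pos z) u u.
Proof. by move=> /unit_phase[Mz _]; have [] := Hg.2 _ Mz. Qed.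

Lemma vel_unit z : curve_dom z -> inner g (pos z) (vel z) (vel z) = 1.
Proof. by move=> /unit_phase[]. Qed.

Lemma vel_neq0 z : curve_dom z -> vel z != 0.
Proof.
move=> Oz; apply/eqP => V0; have /eqP := vel_unit Oz.
by rewrite V0 /inner mul0mx mul0mx mxE eq_sym oner_eq0.
Qed.

Definition cnormal (z : T3) : E := conormal g gam chart dir z.1.1 z.1.2 z.2.
Definition acoef (z : T3) : R := pairing (cnormal z) ('D_e_y pos z).
Definition bcoef (z : T3) : R := pairing (cnormal z) ('D_e_eta pos z).

Lemma cnormal_def z : cnormal z = flat g (pos z) (rot90 g (pos z) (vel z)).
Proof. by case: z => [[y eta] t]; rewrite /cnormal /conormal /normal velocity_curve. Qed.

Lemma pairing_cnormal z u :
  pairing (cnormal z) u = inner g (pos z) (rot90 g (pos z) (vel z)) u.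
Proof. by rewrite cnormal_def. Qed.

Lemma coef_aE y eta t : coef_a g gam chart dir y eta t = acoef (y, eta, t).
Proof. by rewrite /coef_a derive_curve_y. Qed.

Lemma coef_bE y eta t : coef_b g gam chart dir y eta t = bcoef (y, eta, t).
Proof. by rewrite /coef_b derive_curve_eta. Qed.

Lemma smooth_gpos : smooth_on curve_dom (g \o pos).
Proof.
apply: (smooth_comp cE open_curve_dom _ smooth_pos Hg.1).
by move=> z /unit_phase[].
Qed.

Lemma smooth_cnormal : smooth_on curve_dom cnormal.
Proof.
have oD := open_curve_dom.
pose rotV z : E := \row_k (if k == 0 then - vel z 0 1 else vel z 0 0).
have srot : smooth_on curve_dom rotV.
  apply: smooth_matrix => // i j; have [->|j1] := eqVneq j 0.
    apply: smooth_on_ext (smoothN oD (smooth_entry 0 1 oD smooth_vel)) => //.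
    by move=> z _; rewrite mxE eqxx.
  apply: smooth_on_ext (smooth_entry 0 0 oD smooth_vel) => //.
  by move=> z _; rewrite mxE (negbTE j1).
have sdet : smooth_on curve_dom (fun z => \det (g (pos z))).
  apply/smooth_onP => k; apply: ndiff_det => // i j.
  by apply: (ndiff_entry (f := g \o pos)) => //; have /smooth_onP := smooth_gpos; apply.
have spos z : curve_dom z -> 0 < \det (g (pos z)).
  by move=> Oz; apply: metric_det_gt0; [apply: metric_sym|apply: metric_pos].
apply: smooth_on_ext (smooth_scale oD (smooth_sqrt oD spos sdet) srot) => // z Oz.
by rewrite cnormal_def flat_rot90 //; [apply: metric_sym|apply: metric_pos].
Qed.

Lemma dcnormal z : curve_dom z -> differentiable cnormal z.
Proof. exact: smooth_differentiable smooth_cnormal. Qed.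

Lemma smooth_pairing (xi u : T3 -> E) : smooth_on curve_dom xi -> smooth_on curve_dom u ->
  smooth_on curve_dom (fun z => pairing (xi z) (u z)).
Proof.
move=> sxi su; have oD := open_curve_dom.
apply: (@smooth_on_ext _ _ _ _ (fun z => xi z 0 0 * u z 0 0 + xi z 0 1 * u z 0 1)) => //.
  by move=> z _; rewrite pairing2.
by apply: smoothD => //; apply: smoothM => //; apply: smooth_entry.
Qed.

Lemma smooth_acoef : smooth_on curve_dom acoef.
Proof. exact: smooth_pairing smooth_cnormal (smooth_onD _ smooth_pos). Qed.

Lemma smooth_bcoef : smooth_on curve_dom bcoef.
Proof. exact: smooth_pairing smooth_cnormal (smooth_onD _ smooth_pos). Qed.

Lemma pairing_cnormal_vel z : curve_dom z -> pairing (cnormal z) (vel z) = 0.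
Proof.
move=> Oz; rewrite pairing_cnormal inner_rot90_self //; [exact: metric_sym|exact: metric_pos].
Qed.

Lemma cnormal_neq0 z : curve_dom z -> cnormal z != 0.
Proof.
move=> Oz; apply/eqP => E0.
have := inner_rot90 (metric_sym Oz) (metric_pos Oz) (vel z).
rewrite -pairing_cnormal E0 vel_unit // => /eqP.
by rewrite pairing2 !mxE !mul0r addr0 eq_sym oner_eq0.
Qed.

Lemma cnormal_annihilates z u : curve_dom z -> pairing (cnormal z) u = 0 ->
  exists k : R, u = k *: vel z.
Proof.
move=> Oz; rewrite pairing_cnormal; apply: inner_rot90_eq0.
- exact: metric_sym.
- exact: metric_pos.
- exact: vel_neq0.
Qed.

Lemma cnormal_inner_eq0 z u : curve_dom z -> pairing (cnormal z) u = 0 ->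
  inner g (pos z) (vel z) u = 0 -> u = 0.
Proof.
move=> Oz; rewrite pairing_cnormal; apply: inner_both_eq0.
- exact: metric_sym.
- exact: metric_pos.
- exact: vel_neq0.
Qed.

(** The metric at [pos z] is constant along w to first order, so that the unit
    speed condition can be differentiated in the velocity alone. *)
Lemma unit_derive z w : curve_dom z -> 'D_w pos z = 0 ->
  inner g (pos z) (vel z) ('D_w vel z) = 0.
Proof.
move=> Oz Gw; have dV := dvel Oz; have dG := dpos Oz.
have Mz : M (pos z) by have [] := unit_phase Oz.
have dgG : differentiable (g \o pos) z by apply: smooth_differentiable smooth_gpos Oz.
have dg : differentiable g (pos z) by apply: smooth_differentiable Hg.1 Mz.
have Dg : 'D_w (g \o pos) z = 0 by rewrite (derive_comp w dG dg) Gw derive0.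
have dVg := differentiable_mulmx dV dgG.
have := derive_pairing w dVg dV; rewrite (derive_mulmx w dV dgG) Dg mulmx0 addr0.
have -> : 'D_w (fun y => pairing (vel y *m (g \o pos) y) (vel y)) z = 0.
  rewrite -(derive_cst (1 : R) z w); apply: near_eq_derive.
  by apply: filterS (open_near open_curve_dom Oz) => z' Oz'; apply: vel_unit.
rewrite -[pairing ('D_w vel z *m _) _]/(inner g (pos z) ('D_w vel z) (vel z)).
rewrite -[pairing (vel z *m _) _]/(inner g (pos z) (vel z) ('D_w vel z)).
rewrite (inner_sym (metric_sym Oz) ('D_w vel z)).
by move=> /esym/eqP; rewrite -mulr2n mulrn_eq0 /= => /eqP.
Qed.

Lemma derive_cnormal_vel z w : curve_dom z ->
  pairing ('D_w cnormal z) (vel z) = - pairing (cnormal z) ('D_w vel z).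
Proof.
move=> Oz; have := derive_pairing w (dcnormal Oz) (dvel Oz).
have -> : 'D_w (fun y => pairing (cnormal y) (vel y)) z = 0.
  rewrite -(derive_cst (0 : R) z w); apply: near_eq_derive.
  by apply: filterS (open_near open_curve_dom Oz) => z' Oz'; apply: pairing_cnormal_vel.
by move=> /esym/eqP; rewrite addr_eq0 => /eqP.
Qed.

(** The time derivative of d(pos)/dy is d(vel)/dy by symmetry of second
    derivatives. *)
Lemma derive_acoef z : curve_dom z -> 'D_e_t acoef z =
  pairing ('D_e_t cnormal z) ('D_e_y pos z) + pairing (cnormal z) ('D_e_y vel z).
Proof.
move=> Oz; rewrite (derive_pairing e_t (dcnormal Oz)); last first.
  exact: smooth_differentiable (smooth_onD _ smooth_pos) Oz.
by rewrite (derive_comm _ _ open_curve_dom smooth_pos Oz).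
Qed.

Lemma derive_bcoef z : curve_dom z -> 'D_e_t bcoef z =
  pairing ('D_e_t cnormal z) ('D_e_eta pos z) + pairing (cnormal z) ('D_e_eta vel z).
Proof.
move=> Oz; rewrite (derive_pairing e_t (dcnormal Oz)); last first.
  exact: smooth_differentiable (smooth_onD _ smooth_pos) Oz.
by rewrite (derive_comm _ _ open_curve_dom smooth_pos Oz).
Qed.

(** The variation al d/dy + be d/deta, corrected by a multiple of d/dt, changes
    neither the position nor the velocity. *)
Lemma coef_independent z (al be : R) : curve_dom z -> al * acoef z + be * bcoef z = 0 ->
  al * 'D_e_t acoef z + be * 'D_e_t bcoef z = 0 -> al = 0 /\ be = 0.
Proof.
move=> Oz; have dG := dpos Oz; have dV := dvel Oz.
have [w [w1 w2 w3]] : exists w : T3, [/\ w.1.1 = al, w.1.2 = be & w.2 = 0].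
  by exists (al, be, 0).
have DwG : 'D_w pos z = al *: 'D_e_y pos z + be *: 'D_e_eta pos z.
  by rewrite (derive_T3 w dG) w1 w2 w3 scale0r; congr (_ + _); apply: addr0.
have DwV : 'D_w vel z = al *: 'D_e_y vel z + be *: 'D_e_eta vel z.
  by rewrite (derive_T3 w dV) w1 w2 w3 scale0r; congr (_ + _); apply: addr0.
move=> E0; have N0 : pairing (cnormal z) ('D_w pos z) = 0.
  by rewrite DwG pairing_lin.
have [k Ek] := cnormal_annihilates Oz N0.
move=> E1; have {}E1 := etrans (congr2 (fun p q => al * p + be * q)
  (esym (derive_acoef Oz)) (esym (derive_bcoef Oz))) E1.
have {}E1 : pairing ('D_e_t cnormal z) ('D_w pos z) + pairing (cnormal z) ('D_w vel z) = 0.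
  by rewrite DwG DwV !pairing_lin -E1 !mulrDr addrACA.
(* Moving back along the curve by k cancels the tangential displacement. *)
pose w' := - k *: e_t + w.
have G' : 'D_w' pos z = 0 by rewrite (derive_linear _ _ _ dG) Ek scaleNr addNr.
have V' : 'D_w' vel z = 0.
  apply: (cnormal_inner_eq0 Oz); last exact: unit_derive.
  rewrite (derive_linear _ _ _ dV) pairingDr pairingZr mulNr.
  by rewrite -E1 Ek pairingZr derive_cnormal_vel // mulrN.
have w'0 := phase_immersion Oz G' V'.
have w'E : w'.1 = w.1 by rewrite /w' /=; apply: pairP; rewrite /= scaler0 add0r.
by rewrite -w1 -w2 -w'E w'0.
Qed.

(** The vectors (a, b) and (a', b') are independent because [coef_independent]
    excludes a common annihilator.  The derivative of [rel_MM] is then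
    invertible, and a and b have no common zero. *)
Lemma wronskian z : curve_dom z -> acoef z * 'D_e_t bcoef z - bcoef z * 'D_e_t acoef z != 0.
Proof. by move=> Oz; apply: det_neq0 => al be; apply: coef_independent. Qed.

Local Notation T4 := (T3 * R)%type.

Definition rel_dom : set T4 := [set p | curve_dom p.1 /\ p.2 != 0].
Definition rel_M (p : T4) : E * E := (pos p.1, p.2 *: cnormal p.1).
Definition rel_MM (p : T4) : (R * R) * (R * R) := (p.1.1, (p.2 * acoef p.1, p.2 * bcoef p.1)).

Lemma open_rel_dom : open rel_dom.
Proof.
rewrite (_ : rel_dom = [set p : T4 | curve_dom p.1] `&` [set p : T4 | p.2 != 0]); last first.
  by apply/seteqP; split=> [p []|p []].
apply: openI; first exact: open_fst_preimage open_curve_dom.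
apply: (@open_comp _ _ snd [set x : R | x != 0]); last exact: open_neq.
by move=> p _; apply: cvg_snd.
Qed.

Lemma smooth_on_fst (W : normedModType R) (f : T3 -> W) : smooth_on curve_dom f ->
  smooth_on rel_dom (fun p => f p.1).
Proof.
move=> sf; have sid := @smooth_id _ _ rel_dom.
by apply: (smooth_comp cT3 open_rel_dom _ (smooth_fst open_rel_dom sid) sf) => p [].
Qed.

Lemma smooth_rel_M : smooth_on rel_dom rel_M.
Proof.
have oP := open_rel_dom; have s2 := smooth_snd oP (@smooth_id _ _ rel_dom).
apply: smooth_pair => //; first exact: smooth_on_fst smooth_pos.
exact: smooth_scale oP s2 (smooth_on_fst smooth_cnormal).
Qed.

Lemma smooth_rel_MM : smooth_on rel_dom rel_MM.
Proof.
have oP := open_rel_dom; have s2 := smooth_snd oP (@smooth_id _ _ rel_dom).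
have s1 := smooth_fst oP (smooth_fst oP (@smooth_id _ _ rel_dom)).
apply: smooth_pair => //; apply: smooth_pair => //.
  exact: smoothM oP s2 (smooth_on_fst smooth_acoef).
exact: smoothM oP s2 (smooth_on_fst smooth_bcoef).
Qed.

Lemma derive_on_fst (W : normedModType R) (f : T3 -> W) (p w : T4) :
  differentiable f p.1 -> differentiable (fun p : T4 => f p.1) p /\
  'D_w (fun p : T4 => f p.1) p = 'D_(w.1) f p.1.
Proof.
move=> df; split; first exact: differentiable_comp (dfst p) df.
by rewrite (derive_comp w (dfst p) df) derive_fst.
Qed.

Lemma derive_scaled (W : normedModType R) (f : T3 -> W) (p w : T4) :
  differentiable f p.1 -> differentiable (fun p : T4 => p.2 *: f p.1) p /\
  'D_w (fun p : T4 => p.2 *: f p.1) p = w.2 *: f p.1 + p.2 *: 'D_(w.1) f p.1.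
Proof.
move=> df; have [d1 e1] := derive_on_fst w df.
have [d e] := differentiable_scale (dsnd p) d1; split=> //.
rewrite (deriveE _ d) e -(deriveE _ (dsnd p)) -(deriveE _ d1).
by rewrite e1 derive_snd.
Qed.

Lemma derive_rel_M (p w : T4) : curve_dom p.1 ->
  'D_w rel_M p = ('D_(w.1) pos p.1, w.2 *: cnormal p.1 + p.2 *: 'D_(w.1) cnormal p.1).
Proof.
move=> Op; have [d1 e1] := derive_on_fst w (dpos Op).
have [d2 e2] := derive_scaled w (dcnormal Op).
exact: etrans (derive_pair w d1 d2) (congr2 pair e1 e2).
Qed.

Lemma derive_rel_MM (p w : T4) : curve_dom p.1 ->
  'D_w rel_MM p = (w.1.1, (w.2 * acoef p.1 + p.2 * 'D_(w.1) acoef p.1,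
                       w.2 * bcoef p.1 + p.2 * 'D_(w.1) bcoef p.1)).
Proof.
move=> Op; have [da ea] := derive_scaled w (smooth_differentiable smooth_acoef Op).
have [db eb] := derive_scaled w (smooth_differentiable smooth_bcoef Op).
have [d1 e1] := derive_on_fst w (dfst p.1).
rewrite derive_fst in e1.
exact: etrans (derive_pair w d1 (differentiable_pair da db))
  (congr2 pair e1 (etrans (derive_pair w da db) (congr2 pair ea eb))).
Qed.

(** A variation that fixes the point and the direction of the conormal turns the
    velocity neither normally nor tangentially, so [phase_immersion] applies. *)
Lemma rel_M_immersion (p w : T4) : rel_dom p -> 'D_w rel_M p = 0 -> w = 0.
Proof.
move=> [Op p0']; rewrite (derive_rel_M _ Op) => -[G0 E0].
have Dcnormal : 'D_(w.1) cnormal p.1 = - (p.2^-1 * w.2) *: cnormal p.1.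
  apply: (scalerI p0'); rewrite scalerA mulrN mulVKf // scaleNr.
  by apply/eqP; rewrite -addr_eq0 addrC E0.
have V0 : 'D_(w.1) vel p.1 = 0.
  apply: (cnormal_inner_eq0 Op); last exact: unit_derive.
  apply/eqP; rewrite -oppr_eq0 -derive_cnormal_vel // Dcnormal pairingZl.
  by rewrite pairing_cnormal_vel // mulr0.
have w1 := phase_immersion Op G0 V0.
apply: pairP => //; move: E0; rewrite w1 derive0 scaler0 addr0 => /eqP.
by rewrite scaler_eq0 (negbTE (cnormal_neq0 Op)) orbF => /eqP.
Qed.

(** With y and eta fixed, what remains is the matrix of (mu, t) |-> (mu a, mu b),
    whose determinant is mu times the Wronskian. *)
Lemma rel_MM_immersion (p w : T4) : rel_dom p -> 'D_w rel_MM p = 0 -> w = 0.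
Proof.
move=> [Op p0']; rewrite (derive_rel_MM _ Op) => -[w11 Ea Eb].
have [da db] : differentiable acoef p.1 /\ differentiable bcoef p.1.
  by split; [apply: smooth_differentiable smooth_acoef Op
            |apply: smooth_differentiable smooth_bcoef Op].
have w1 : w.1 = w.1.2 *: e_t.
  apply: pairP; first by rewrite w11; do ?[apply: pairP]; rewrite /= scaler0.
  by rewrite /= [_ *: _]mulr1.
have Da : 'D_(w.1) acoef p.1 = w.1.2 *: 'D_e_t acoef p.1.
  by rewrite {1}w1; apply: derive_scalev da.
have Db : 'D_(w.1) bcoef p.1 = w.1.2 *: 'D_e_t bcoef p.1.
  by rewrite {1}w1; apply: derive_scalev db.
rewrite {}Da in Ea; rewrite {}Db in Eb.
have [w2 w12] := wronskian_kernel (wronskian Op) p0' Ea Eb.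
by apply: pairP => //; rewrite w1 w12 scale0r.
Qed.

Section Polar.
Context (p v n : E) (tau : R).

Definition polar (z : E) : E * E * R :=
  ((p, cos (z 0 1) *: v + sin (z 0 1) *: n), z 0 0).

Definition polar0 : E := \row_(k < 2) (if k == 0 then tau else 0).

Lemma polar0E : polar polar0 = ((p, v), tau).
Proof. by rewrite /polar !mxE /= cos0 sin0 scale1r scale0r addr0. Qed.

Lemma derive_polar w : differentiable polar polar0 /\
  'D_w polar polar0 = ((0, w 0 1 *: n), w 0 0).
Proof.
have d0 : differentiable (fun z : E => z 0 0) polar0 by apply: differentiable_coord.
have d1 : differentiable (fun z : E => z 0 1) polar0 by apply: differentiable_coord.
have D0 : 'D_w (fun z : E => z 0 0) polar0 = w 0 0.
  rewrite -[LHS](derive_entry _ _ _ (f := id)) ?derive_id //.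
have D1 : 'D_w (fun z : E => z 0 1) polar0 = w 0 1.
  rewrite -[LHS](derive_entry _ _ _ (f := id)) ?derive_id //.
have z01 : polar0 0 1 = 0 by rewrite mxE.
have dcos : differentiable (@cos R) (polar0 0 1).
  by apply/derivable1_diffP; have [] := is_derive_cos (polar0 0 1).
have dsin : differentiable (@sin R) (polar0 0 1).
  by apply/derivable1_diffP; have [] := is_derive_sin (polar0 0 1).
have Dcos : 'D_w (@cos R \o (fun z : E => z 0 1)) polar0 = 0.
  rewrite (derive_comp w d1 dcos) D1 -[w 0 1](mulr1 (w 0 1)).
  rewrite (derive_scalev _ _ dcos).
  by have [_ ->] := is_derive_cos (polar0 0 1); rewrite z01 sin0 oppr0 scaler0.
have Dsin : 'D_w (@sin R \o (fun z : E => z 0 1)) polar0 = w 0 1.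
  rewrite (derive_comp w d1 dsin) D1 -[X in 'D_X _ _](mulr1 (w 0 1)).
  rewrite (derive_scalev _ _ dsin).
  by have [_ ->] := is_derive_sin (polar0 0 1); rewrite z01 cos0 [_ *: _]mulr1.
have dc1 := differentiable_comp d1 dcos; have ds1 := differentiable_comp d1 dsin.
have [dcv ecv] := derive_scale_cst w v dc1.
have [dsn esn] := derive_scale_cst w n ds1.
have dvn := differentiableD dcv dsn.
have dpvn := differentiable_pair (differentiable_cst p polar0) dvn.
split; first exact: differentiable_pair dpvn d0.
apply: etrans (derive_pair w dpvn d0) _; congr pair => //.
apply: etrans (derive_pair w (differentiable_cst p polar0) dvn) _.
congr pair; first exact: derive_cst.
rewrite deriveD; last 2 first.
- exact: diff_derivable.
- exact: diff_derivable.
rewrite Dcos in ecv; rewrite Dsin in esn.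
by apply: etrans (congr2 +%R ecv esn) _; rewrite scale0r add0r.
Qed.

End Polar.

Section Conjugate.
Context (z1 : T3) (tau : R) (O1 : curve_dom z1) (O2 : curve_dom (tshift tau z1)).

Let v := vel z1.
Let n := rot90 g (pos z1) v.

(** Close to the polar coordinates (tau, 0), the exponential map is the smooth
    extension h composed with a map into the unit bundle; so the rows of its
    Jacobian and the variations of the curves at time t + tau are values of the
    derivative of h. *)
Lemma exp_polar_derivatives : exists (U : set (E * E * R)) (h : E * E * R -> E),
  let th := 'D_((0, n, 0) : E * E * R) h (phase z1, tau) in
  [/\ forall w, 'D_w pos (tshift tau z1) =
        'D_(('D_w pos z1, 'D_w vel z1, 0) : E * E * R) h (phase z1, tau),
      differentiable h (phase z1, tau) &
      forall j, jacobian (exp_polar g gam (pos z1) v) (polar0 tau) 0 j = vel (tshift tau z1) 0 j /\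
        jacobian (exp_polar g gam (pos z1) v) (polar0 tau) 1 j = th 0 j].
Proof.
have [U [h [oU Uz smh hgam hE]]] := flow_relation O1 O2.
exists U, h => th.
have dh : differentiable h (phase z1, tau) by apply: smooth_differentiable smh Uz.
split=> // [w|j]; first by have [] := flow_derive O1 oU Uz smh hE w.
pose P := polar (pos z1) v n; pose ex := exp_polar g gam (pos z1) v.
have dP : differentiable P (polar0 tau).
  by have [] := derive_polar (pos z1) v n tau 0.
have P0 : P (polar0 tau) = (phase z1, tau) by apply: polar0E.
have dhP : differentiable h (P (polar0 tau)) by rewrite P0.
have unitP z : unit_bundle M g (P z).1.
  have [Mz uz] := unit_phase O1; split=> //=.
  apply: inner_circle => //; [exact: metric_sym|exact: metric_pos|exact: cos2Dsin2].
have nexp : \forall z \near polar0 tau, (h \o P) z = ex z.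
  have cP : {for polar0 tau, continuous P} by apply: differentiable_continuous.
  have UP : U (P (polar0 tau)) by rewrite P0.
  apply: filterS (open_preimage_at cP oU UP) => z UPz.
  by rewrite /= hgam //; apply: unitP.
have dcomp := differentiable_comp dP dhP.
have [dex Eex] := near_eq_diff nexp dcomp.
have Dex w : 'D_w ex (polar0 tau) = 'D_(((0, w 0 1 *: n), w 0 0) : E * E * R) h (phase z1, tau).
  rewrite (deriveE _ dex) Eex -(deriveE _ dcomp) (derive_comp w dP dhP) P0.
  by have [_ ->] := derive_polar (pos z1) v n tau w.
rewrite !(jacobian_entry _ _ dex) !Dex !mxE /=; split.
  rewrite scale0r (flow_velocity oU hE O1 Uz); by [].
by rewrite scale1r.
Qed.

(** The variation w' fixes the point at time t and moves the velocity by kap n with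
    kap <> 0; at time t + tau it is therefore kap times the derivative in the angle.
    Comparing normal components, the Jacobian determinant of the exponential
    map is, up to a nonzero factor, the cross product of (a, b) at the two times. *)
Lemma conjugate_criterion :
  conjugate_along g gam (pos z1) v tau <->
  acoef z1 * bcoef (tshift tau z1) - acoef (tshift tau z1) * bcoef z1 = 0.
Proof.
set z2 := tshift tau z1.
have [U [h [H dh Hj]]] := exp_polar_derivatives.
set th := 'D_((0, n, 0) : E * E * R) h (phase z1, tau) in Hj.
rewrite /conjugate_along -/(polar0 tau) rank_lt2 det2.
have [-> ->] := Hj 0; have [-> ->] := Hj 1; rewrite -/z2.
have Eth : pairing (cnormal z2) th = Num.sqrt (\det (g (pos z2))) *
    (vel z2 0 0 * th 0 1 - vel z2 0 1 * th 0 0).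
  by rewrite pairing_cnormal; apply: inner_rot90_left; [apply: metric_sym|apply: metric_pos].
have s0 : Num.sqrt (\det (g (pos z2))) != 0.
  by rewrite gt_eqF // sqrtr_gt0 metric_det_gt0 //; [apply: metric_sym|apply: metric_pos].
(* The combination of d/dy and d/deta with no normal component at time t. *)
have [w [w1 w2 w3]] : exists w : T3, [/\ w.1.1 = bcoef z1, w.1.2 = - acoef z1 & w.2 = 0].
  by exists (bcoef z1, - acoef z1, 0).
have Dw (f : T3 -> E) z : differentiable f z ->
    'D_w f z = bcoef z1 *: 'D_e_y f z + - acoef z1 *: 'D_e_eta f z.
  move=> df; rewrite (derive_T3 w df) w1 w2 w3 scale0r.
  by congr (_ + _); apply: addr0.
have N0 : pairing (cnormal z1) ('D_w pos z1) = 0.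
  rewrite (Dw _ _ (dpos O1)) pairing_lin; apply: (cross0 (bcoef z1) (acoef z1)).
have [k Ek] := cnormal_annihilates O1 N0.
pose w' := - k *: e_t + w.
have G' : 'D_w' pos z1 = 0 by rewrite (derive_linear _ _ _ (dpos O1)) Ek scaleNr addNr.
have [kap Ekap] : exists kap, 'D_w' vel z1 = kap *: n.
  apply: (inner_eq0 (metric_sym O1) (metric_pos O1) (vel_neq0 O1)).
  exact: unit_derive.
have kap0 : kap != 0.
  apply/eqP => kap0; rewrite kap0 scale0r in Ekap.
  have w'0 := phase_immersion O1 G' Ekap.
  have w'E : w'.1 = w.1 by rewrite /w' /=; apply: pairP; rewrite /= scaler0 add0r.
  have cb0 : bcoef z1 = 0 by rewrite -w1 -w'E w'0.
  have ca0 : acoef z1 = 0 by apply/eqP; rewrite -oppr_eq0 -w2 -w'E w'0.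
  by have /eqP[] := wronskian O1; apply: (zero_det _ _ ca0 cb0).
have Ez2 : kap * pairing (cnormal z2) th = bcoef z1 * acoef z2 - acoef z1 * bcoef z2.
  have D2 : 'D_w' pos z2 = kap *: th.
    rewrite H G' Ekap -(derive_scalev kap _ dh); congr ('D_ _ _ _).
    by do 2?[apply: pairP]; rewrite /= ?scaler0.
  rewrite -pairingZr -D2 (derive_linear _ _ _ (dpos O2)) pairingDr pairingZr.
  rewrite pairing_cnormal_vel // mulr0 add0r (Dw _ _ (dpos O2)) pairing_lin.
  by rewrite mulNr.
have -> : acoef z1 * bcoef z2 - acoef z2 * bcoef z1 =
    - (kap * Num.sqrt (\det (g (pos z2)))) * (vel z2 0 0 * th 0 1 - vel z2 0 1 * th 0 0).
  exact: cross_factor Ez2 Eth.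
split=> [->|/eqP]; first by rewrite mulr0.
by rewrite mulf_eq0 oppr_eq0 mulf_eq0 (negbTE kap0) (negbTE s0) => /eqP.
Qed.

End Conjugate.

Lemma conjugate_atE y eta t1 t2 : curve_dom (y, eta, t1) -> curve_dom (y, eta, t2) ->
  conjugate_at g gam chart dir y eta t1 t2 <->
  acoef (y, eta, t1) * bcoef (y, eta, t2) - acoef (y, eta, t2) * bcoef (y, eta, t1) = 0.
Proof.
move=> O1 O2; have E2 : tshift (t2 - t1) (y, eta, t1) = (y, eta, t2).
  by rewrite /tshift /= addrC subrK.
have O2' : curve_dom (tshift (t2 - t1) (y, eta, t1)) by rewrite E2.
by rewrite /conjugate_at velocity_curve -E2; apply: (conjugate_criterion O1 O2').
Qed.

Let cT4 : coords 4 T4 := coords_prod cT3 coords_R.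
Let cEE : coords 4 (E * E)%type := coords_prod cE cE.
Let cRRRR : coords 4 ((R * R) * (R * R))%type := coords_prod cRR cRR.

Lemma common_chart p : rel_dom p -> exists V : set T4,
  [/\ V p, V `<=` rel_dom, diffeo_onto_image V rel_M & diffeo_onto_image V rel_MM].
Proof.
move=> Pp; have [V1 [V1p V1P dF]] := inverse_function cT4 cEE open_rel_dom Pp smooth_rel_M
  (fun w => rel_M_immersion Pp).
have [oV1 _ _ _] := dF.
have [V2 [V2p V21 dK]] := inverse_function cT4 cRRRR oV1 V1p
  (smooth_onS V1P smooth_rel_MM) (fun w => rel_MM_immersion Pp).
exists V2; split=> //; first by move=> q /V21/V1P.
by apply: diffeo_restrict dF _ V21; case: dK.
Qed.

Lemma coef_neq0 z : curve_dom z -> acoef z = 0 -> bcoef z <> 0.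
Proof.
move=> Oz ca0 cb0; have /eqP[] := wronskian Oz; exact: (zero_det _ _ ca0 cb0).
Qed.

Lemma rel_MM_eqP p1 p2 : rel_MM p1 = rel_MM p2 ->
  [/\ p1.1.1 = p2.1.1, p1.2 * acoef p1.1 = p2.2 * acoef p2.1 &
      p1.2 * bcoef p1.1 = p2.2 * bcoef p2.1].
Proof.
move=> e; pose RR := ((R * R) * (R * R))%type; split.
- exact (f_equal (fun q : RR => q.1) e).
- exact (f_equal (fun q : RR => q.2.1) e).
- exact (f_equal (fun q : RR => q.2.2) e).
Qed.

Lemma rel_MM_injective_at z (m1 m2 : R) : curve_dom z -> rel_MM (z, m1) = rel_MM (z, m2) -> m1 = m2.
Proof. by move=> Oz /rel_MM_eqP[_ Ea Eb]; apply: (scale_unique (coef_neq0 Oz) Ea Eb). Qed.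

Lemma param_domE : param_dom I chart D dir = rel_dom.
Proof.
by apply/seteqP; split=> [[[[y eta] t] mu] [? ? ?]|[[[y eta] t] mu] [[? ?] ?]]; split.
Qed.

Lemma paramE p : param g gam chart dir p = (rel_MM p, rel_M p).
Proof.
case: p => [[[y eta] t] mu]; rewrite /param coef_aE coef_bE //.
Qed.

Section LocalSetting.

Let CR := canonical_relation g I gam chart D dir.
Let TsM := cotangent_M I gam chart D dir.
Let C := canonical_map g I gam chart D dir.
Let joined12 := joined g I gam chart D dir.
Context (Hbij : set_bij CR TsM (@pi_M R)).

Lemma CR_param p : rel_dom p -> CR (rel_MM p, rel_M p).
Proof. by move=> Pp; exists p; rewrite ?param_domE // paramE. Qed.

Lemma CRP q : CR q -> exists2 p, rel_dom p & q = (rel_MM p, rel_M p).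
Proof. by move=> [p]; rewrite param_domE => Pp <-; exists p; rewrite ?paramE. Qed.

Lemma rel_M_cotangent p : rel_dom p -> TsM (rel_M p).
Proof. by have [H _ _] := Hbij => /CR_param/H. Qed.

Lemma cotangentP z : TsM z -> exists2 p, rel_dom p & z = rel_M p.
Proof. by have [_ _ H] := Hbij => /H[q /CRP[p Pp ->] <-]; exists p. Qed.

(** [pinv] picks the only point of the relation above the given covector, by the
    injectivity of pi_M. *)
Lemma canonical_map_rel_M p : rel_dom p -> C (rel_M p) = rel_MM p.
Proof.
move=> Pp; have [_ inj _] := Hbij; have Cp := CR_param Pp.
have H := pinvKV (fun=> point) inj (mem_set Cp).
apply: (etrans (congr1 (@pi_MM R) H)).
by [].
Qed.

(** On a set where [rel_M] and [rel_MM] are both diffeomorphisms onto their images,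
    the canonical map and its inverse are composed from them. *)
Lemma canonical_map_local z : TsM z ->
  exists U : set (E * E), [/\ U z, U `<=` TsM & diffeo_onto_image U C].
Proof.
move=> /cotangentP[p Pp ->].
have [V [Vp VP [oV oFV sF [hF [shF hFK]]] [_ oKV sK [hK [shK hKK]]]]] := common_chart Pp.
exists (rel_M @` V); split; first by exists p.
  by move=> _ [q Vq <-]; apply/rel_M_cotangent/VP.
have imC : C @` (rel_M @` V) = rel_MM @` V.
  apply/seteqP; split=> [_ [_ [q Vq <-] <-]|_ [q Vq <-]].
    by exists q => //; rewrite canonical_map_rel_M //; apply: VP.
  exists (rel_M q); first by exists q.
  by rewrite canonical_map_rel_M //; apply: VP.
split=> //; first by rewrite imC.
  have sKh : smooth_on (rel_M @` V) (rel_MM \o hF).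
    by apply: (smooth_comp cT4 oFV _ shF sK) => _ [q Vq <-]; rewrite hFK.
  apply: smooth_on_ext sKh => // _ [q Vq <-] /=.
  by rewrite hFK // canonical_map_rel_M //; apply: VP.
exists (rel_M \o hK); rewrite imC; split.
  by apply: (smooth_comp cT4 oKV _ shK sF) => _ [q Vq <-]; rewrite hKK.
move=> _ [q Vq <-] /=; rewrite canonical_map_rel_M; last exact: VP.
by rewrite hKK.
Qed.

Lemma canonical_map_cotangent z : TsM z -> cotangent_MM D (C z).
Proof.
move=> /cotangentP[p [[Dp Ip] p0'] ->]; have Pp : rel_dom p by [].
rewrite canonical_map_rel_M //; split=> //; apply/eqP => -[Ea Eb].
exact: (coef_neq0 (conj Dp Ip) (mul_eq0_right p0' Ea) (mul_eq0_right p0' Eb)).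
Qed.

Lemma joined_of_rel_MM_eq y eta (t1 t2 m1 m2 : R) :
  rel_dom (y, eta, t1, m1) -> rel_dom (y, eta, t2, m2) -> t1 < t2 ->
  rel_MM (y, eta, t1, m1) = rel_MM (y, eta, t2, m2) ->
  joined12 (rel_M (y, eta, t1, m1)) (rel_M (y, eta, t2, m2)).
Proof.
move=> [Oz1 n1] [Oz2 n2] t12 /rel_MM_eqP[_ Ea Eb].
have [D1 I1] := Oz1; have [_ I2] := Oz2.
exists y, eta, t1, t2; split; [exact: And4 D1 I1 I2 t12|exact: erefl|exact: erefl| |].
  apply/(conjugate_atE Oz1 Oz2); exact: cross_of_proportional n1 Ea Eb.
case: (proportional_cases n1 n2 Ea Eb (coef_neq0 Oz1))
  => [[mu [mu0 e1 e2]]|[a1 a2 [mu [mu0 e1 e2]]]].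
  left; exists mu; rewrite !coef_aE; split; [exact: mu0| |].
    by rewrite -e1.
  by rewrite -e2.
right; rewrite !coef_aE; split; [exact: a1|exact: a2|].
exists mu; rewrite !coef_bE; split; [exact: mu0| |].
  by rewrite -e1.
by rewrite -e2.
Qed.

Lemma canonical_map_joined z1 z2 : TsM z1 -> TsM z2 -> joined12 z1 z2 -> C z1 = C z2.
Proof.
case: z1 z2 => [x1 xi1] [x2 xi2] [/= n1 _] [/= n2 _].
move=> [y [eta [t1 [t2 [[Dy I1 I2 _] /= -> -> cj cond]]]]].
have Oz1 : curve_dom (y, eta, t1) by [].
have Oz2 : curve_dom (y, eta, t2) by [].
move/(conjugate_atE Oz1 Oz2)/subr0_eq: cj => cross.
have key m1 m2 : xi1 = m1 *: cnormal (y, eta, t1) -> xi2 = m2 *: cnormal (y, eta, t2) ->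
    m1 * acoef (y, eta, t1) = m2 * acoef (y, eta, t2) ->
    m1 * bcoef (y, eta, t1) = m2 * bcoef (y, eta, t2) ->
    C (pos (y, eta, t1), xi1) = C (pos (y, eta, t2), xi2).
  move=> e1 e2 Ea Eb.
  have P1 : rel_dom (y, eta, t1, m1).
    by split; [exact: Oz1|move: n1; rewrite e1; exact: scale_neq0].
  have P2 : rel_dom (y, eta, t2, m2).
    by split; [exact: Oz2|move: n2; rewrite e2; exact: scale_neq0].
  have EK : rel_MM (y, eta, t1, m1) = rel_MM (y, eta, t2, m2).
    exact (f_equal (fun q => ((y, eta), q)) (f_equal2 pair Ea Eb)).
  rewrite e1 e2.
  exact: etrans (canonical_map_rel_M P1) (etrans EK (esym (canonical_map_rel_M P2))).
case: cond => [[mu [_ e1 e2]]|[a1 a2 [mu [_ e1 e2]]]].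
  rewrite coef_aE in e1; rewrite coef_aE in e2.
  by apply: (key _ _ e1 e2); [exact: mulrAC|exact: cross_scaled].
rewrite coef_aE in a1; rewrite coef_aE in a2.
rewrite coef_bE in e1; rewrite coef_bE in e2.
by apply: (key _ _ e1 e2); [exact: mul_eq0_both|exact: mulrAC].
Qed.

(** Equality of images means the same curve with proportional (a, b); at equal
    times the factors would agree, since (a, b) <> 0, and then z1 = z2. *)
Lemma canonical_map_eqP z1 z2 : TsM z1 -> TsM z2 -> z1 <> z2 ->
  (C z1 = C z2 <-> joined12 z1 z2 \/ joined12 z2 z1).
Proof.
move=> T1 T2 z12; split; last first.
  by case=> [|j]; [exact: canonical_map_joined|apply/esym; exact: canonical_map_joined].
have [[[[y1 eta1] t1] m1] P1 E1] := cotangentP T1.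
have [[[[y2 eta2] t2] m2] P2 E2] := cotangentP T2.
rewrite E1 E2 => EC.
have EK := etrans (esym (canonical_map_rel_M P1)) (etrans EC (canonical_map_rel_M P2)).
have [[e_y e_eta] _ _] := rel_MM_eqP EK; subst y2 eta2.
have [t12|t21|t12] := ltgtP t1 t2.
- by left; exact: (joined_of_rel_MM_eq P1 P2 t12 EK).
- by right; exact: (joined_of_rel_MM_eq P2 P1 t21 (esym EK)).
subst t2; have m12 := rel_MM_injective_at P1.1 EK.
by exfalso; apply: z12; rewrite E1 E2 m12.
Qed.

Section NoConjugatePoints.
Context (Hnc : no_conjugate_points g I gam chart D dir).

Lemma no_joined z1 z2 : ~ joined12 z1 z2.
Proof. by move=> [y [eta [t1 [t2 [[Dy I1 I2 t12] _ _ cj _]]]]]; apply: (Hnc Dy I1 I2 t12). Qed.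

Lemma canonical_map_injective z1 z2 : TsM z1 -> TsM z2 -> C z1 = C z2 -> z1 = z2.
Proof.
move=> T1 T2 EC; have [//|z12] := pselect (z1 = z2).
by have [/(_ EC)[/no_joined|/no_joined]] := canonical_map_eqP T1 T2 z12.
Qed.

Lemma bolker_of_no_conjugate : bolker g I gam chart D dir.
Proof.
split.
  move=> q1 q2 /set_mem/CRP[p1 P1 ->] /set_mem/CRP[p2 P2 ->] EK.
  have EC : C (rel_M p1) = C (rel_M p2).
    exact: etrans (canonical_map_rel_M P1) (etrans EK (esym (canonical_map_rel_M P2))).
  have EF := canonical_map_injective (rel_M_cotangent P1) (rel_M_cotangent P2) EC.
  exact (f_equal2 pair EK EF).
rewrite param_domE (_ : _ \o _ = rel_MM); last by apply/funext => p /=; rewrite paramE.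
split=> [|p Pp]; first exact: smooth_rel_MM.
have dK : differentiable rel_MM p by apply: smooth_differentiable smooth_rel_MM Pp.
move=> w1 w2 Ew; apply/eqP; rewrite -subr_eq0; apply/eqP.
by apply: (rel_MM_immersion Pp); rewrite (deriveE _ dK) linearB Ew subrr.
Qed.

(** The local inverses agree with the global one, which exists by injectivity. *)
Lemma diffeo_of_no_conjugate : diffeo_onto_image TsM C.
Proof.
have oT : open TsM.
  rewrite openE => z /canonical_map_local[U [Uz UT [oU _ _ _]]]; rewrite /interior.
  by apply: filterS (open_near oU Uz) => z' /UT.
have oCT : open (C @` TsM).
  rewrite openE => _ [z Tz <-]; rewrite /interior.
  have [U [Uz UT [oU oCU _ _]]] := canonical_map_local Tz.
  have CUz : (C @` U) (C z) by exists z.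
  by apply: filterS (open_near oCU CUz) => _ [z' /UT Tz' <-]; exists z'.
pose h w := xget point [set z | TsM z /\ C z = w].
have hK z : TsM z -> h (C z) = z.
  move=> Tz; have [] := @xgetPex _ point [set z' | TsM z' /\ C z' = C z]; first by exists z.
  by move=> Th; apply: canonical_map_injective.
split=> //.
  apply: smooth_on_local => z /canonical_map_local[U [Uz UT [oU _ sC _]]].
  by exists U, C; split.
exists h; split=> //; apply: smooth_on_local => _ [z Tz <-].
have [U [Uz UT [oU oCU _ [k [sk kK]]]]] := canonical_map_local Tz.
exists (C @` U), k; split=> //.
by move=> _ [z' Uz' <-]; rewrite kK // hK //; apply: UT.
Qed.

End NoConjugatePoints.
End LocalSetting.

End Curves.

Theorem theorem3p1 (R : realType)
  (M : set 'rV[R]_2) (g : 'rV[R]_2 -> 'M[R]_2)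
  (G : 'rV[R]_2 -> 'rV[R]_2 -> 'rV[R]_2) (m : 'rV[R]_2 -> 'rV[R]_2 -> R)
  (J : 'rV[R]_2 -> 'rV[R]_2 -> set R) (c : 'rV[R]_2 -> 'rV[R]_2 -> R -> 'rV[R]_2)
  (I : 'rV[R]_2 -> 'rV[R]_2 -> set R) (gam : 'rV[R]_2 -> 'rV[R]_2 -> R -> 'rV[R]_2)
  (O : set (R * R)) (chart : R * R -> 'rV[R]_2)
  (D : set (R * R)) (dir : R -> R -> 'rV[R]_2)
  (y0 eta0 : R) (p0 v0 : 'rV[R]_2) :
  bounded_domain M ->
  riemannian_metric M g ->
  curve_family M g G m J c ->
  unit_speed_curves M g J c I gam ->
  local_parameterization M g O chart D dir y0 eta0 p0 v0 ->
  set_bij (canonical_relation g I gam chart D dir)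
    (cotangent_M I gam chart D dir) (@pi_M R) ->
  let TsM := cotangent_M I gam chart D dir in
  let C := canonical_map g I gam chart D dir in
  [/\ local_diffeo TsM (cotangent_MM D) C,
      forall z1 z2, TsM z1 -> TsM z2 -> z1 <> z2 ->
        (C z1 = C z2 <->
         joined g I gam chart D dir z1 z2 \/ joined g I gam chart D dir z2 z1) &
      no_conjugate_points g I gam chart D dir ->
        bolker g I gam chart D dir /\ diffeo_onto_image TsM C].
Proof.
move=> _ Hg _ Hus Hlp Hbij TsM C; split.
- split=> z Tz; first exact: (canonical_map_cotangent Hg Hus Hlp Hbij Tz).
  exact: (canonical_map_local Hg Hus Hlp Hbij Tz).
- by move=> z1 z2; apply: (canonical_map_eqP Hg Hus Hlp Hbij).
move=> Hnc; split.
  exact: (bolker_of_no_conjugate Hg Hus Hlp Hbij Hnc).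
exact: (diffeo_of_no_conjugate Hg Hus Hlp Hbij Hnc).
Qed.
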